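(* Let $\mathbf k$ be a field of characteristic zero, and let $P$ be an operad in complexes of $\mathbf k$-vector spaces with homology of finite type. The following statements are equivalent: (1) $P$ is formal. (2) There exists a model $P'$ of $P$ such that $H:\mathrm{Aut}(P')\to\mathrm{Aut}(HP)$ is surjective. (3) There exist a model $P'$ of $P$ and $f\in\mathrm{Aut}(P')$ such that $H(f)=\phi_\alpha$ for some $\alpha\in\mathbf k^*$ that is not a root of unity. (4) There exists a pure endomorphism $f$ (with respect to some weight function on $\mathbf k$) of a model $P'$ of $P$.
   Context: Operads. Complexes of $\mathbf k$-vector spaces have differential of degree $-1$, with Koszul signs. ''Operad'' means pseudo-operad (non-unital Markl operad): a sequence $P=(P(l))_{l\ge1}$ of complexes with right $\Sigma_l$-actions and chain maps $\circ_i:P(l)\otimes P(m)\to P(l+m-1)$, $1\le i\le l$, satisfying the usual associativity and equivariance axioms; it is assumed throughout that $HP(1)=0$. $HP$ is the operad of componentwise homology (zero differential). A weak equivalence is a morphism of operads inducing a homology isomorphism in each arity. Two operads are weakly equivalent if joined by a finite zigzag of weak equivalences; then each is called a model of the other. $P$ is formal if it is weakly equivalent to $HP$. $P$ has homology of finite type if $HP(l)$ is a finite dimensional $\mathbf k$-vector space for each $l$. $\mathrm{Aut}$ denotes the group of operad automorphisms; for a model $P'$ of $P$, $HP'$ is identified with $HP$ via the zigzag. Grading automorphism. For $\alpha\in\mathbf k^*$, $\phi_\alpha$ is the automorphism of $HP$ which is multiplication by $\alpha^i$ on homological degree $i$. Purity. A weight function on $\mathbf k$ is a group morphism $w:\Gamma\to\mathbb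 Z$ on a subgroup $\Gamma\subset\overline{\mathbf k}^*$. An endomorphism of a finite dimensional $\mathbf k$-vector space is pure of weight $n$ if all the roots $\lambda\in\overline{\mathbf k}$ of its characteristic polynomial lie in $\Gamma$ and satisfy $w(\lambda)=n$. An endomorphism $f$ of an operad $P'$ is called pure if, for all arities $l$ and degrees $i$, $H_i(f(l))$ on $H_iP'(l)$ is pure of weight $i$ (i.e. $f$ is pure of weight $0$). *)

(* Defs.v *)
From HB Require Import structures.
From mathcomp Require Import all_boot all_order all_algebra all_fingroup.
From mathcomp Require Import ring_quotient generic_quotient zify.
From mathcomp Require Import boolp.

Set Implicit Arguments.
Unset Strict Implicit.
Unset Printing Implicit Defensive.

Import GRing.Theory.
Local Open Scope ring_scope.
Local Open Scope quotient_scope.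

(* The differential [C_i -> C_(i-1)] takes its target degree [j] together with
   a proof of [i = j + 1]; likewise for the arities and degrees of the partial
   compositions below.  This keeps every axiom free of transports along
   equalities of indices. *)
Record complex (k : fieldType) := Complex {
  cx_obj :> int -> lmodType k;
  cx_d : forall i j : int, i = j + 1 -> {linear cx_obj i -> cx_obj j};
  cx_dd : forall (i j h : int) (e : i = j + 1) (e' : j = h + 1) (x : cx_obj i),
    cx_d e' (cx_d e x) = 0
}.

Record chain_map (k : fieldType) (C D : complex k) := ChainMap {
  cm_fun :> forall i, {linear C i -> D i};
  cm_d : forall (i j : int) (e : i = j + 1) (x : C i),
    cm_fun j (cx_d C e x) = cx_d D e (cm_fun i x)
}.

Section ChainMaps.
Variable k : fieldType.

Definition cm_id (C : complex k) : chain_map C C.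
Proof.
by exists (fun i => GRing.Linear.clone _ _ _ _ (@idfun (C i)) _).
Defined.

Definition cm_comp (C D E : complex k)
  (g : chain_map D E) (f : chain_map C D) : chain_map C E.
Proof.
exists (fun i => GRing.Linear.clone _ _ _ _ (g i \o f i) _).
by move=> i j e x /=; rewrite !cm_d.
Defined.

Section Inverse.
Variables (C D : complex k) (f : chain_map C D).
Hypothesis bij_f : forall i, bijective (f i).

Lemma cm_surj i (y : D i) : exists x, f i x == y.
Proof. by have [g _ gK] := bij_f i; exists (g y); rewrite gK. Qed.

Definition cm_inv_fun i (y : D i) : C i := xchoose (cm_surj y).

Lemma cm_inv_funK i : cancel (@cm_inv_fun i) (f i).
Proof. by move=> y; apply/eqP/(xchooseP (cm_surj y)). Qed.

Lemma cm_inv_fun_is_linear i : linear (@cm_inv_fun i).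
Proof.
by move=> c x y; apply: (bij_inj (bij_f i)); rewrite linearP !cm_inv_funK.
Qed.

HB.instance Definition _ i :=
  GRing.isLinear.Build k (D i) (C i) *:%R (@cm_inv_fun i)
    (@cm_inv_fun_is_linear i).

Definition cm_inv : chain_map D C.
Proof.
exists (fun i => GRing.Linear.clone _ _ _ _ (@cm_inv_fun i) _).
move=> i j e x /=; apply: (bij_inj (bij_f j)).
by rewrite cm_d !cm_inv_funK.
Defined.

End Inverse.
End ChainMaps.

Section Homology.
Variables (k : fieldType) (C : complex k) (i : int).

Definition is_cycle : {pred C i} :=
  fun x => cx_d C (esym (subrK 1 i) : i = i - 1 + 1) x == 0.

Lemma cycle_submod : submod_closed is_cycle.
Proof.
split=> [|c x y]; rewrite !unfold_in ?linear0 // => /eqP hx /eqP hy.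
by rewrite linearP hx hy scaler0 addr0.
Qed.
HB.instance Definition _ := GRing.isSubmodClosed.Build k (C i) is_cycle cycle_submod.

Record cycles := Cycle { cycle_val :> C i; cycle_valP : cycle_val \in is_cycle }.
HB.instance Definition _ := [isSub for cycle_val].
HB.instance Definition _ := [Choice of cycles by <:].
HB.instance Definition _ := [SubChoice_isSubLmodule of cycles by <:].

Definition is_boundary : {pred cycles} :=
  fun z => `[< exists y : C (i + 1), cx_d C (erefl (i + 1)) y = val z >].

Lemma boundary_submod : submod_closed is_boundary.
Proof.
split=> [|c x y]; rewrite !unfold_in.
  by apply/asboolP; exists 0; rewrite linear0.
move=> /asboolP[x' hx] /asboolP[y' hy]; apply/asboolP.
by exists (c *: x' + y'); rewrite linearP hx hy.
Qed.
HB.instance Definition _ :=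
  GRing.isSubmodClosed.Build k cycles is_boundary boundary_submod.

Definition homology : Type := Quotient.quot is_boundary.
HB.instance Definition _ := ZmodQuotient.on homology.

Definition homology_scale (c : k) (a : homology) : homology :=
  \pi_homology (c *: repr a).

Lemma pi_homologyD (x y : cycles) :
  \pi_homology (x + y) = \pi_homology x + \pi_homology y.
Proof. exact: raddfD. Qed.

Lemma pi_scale c (z : cycles) :
  homology_scale c (\pi_homology z) = \pi_homology (c *: z).
Proof.
apply/eqP; rewrite /homology_scale -[_ == _]Quotient.idealrBE -scalerBr.
by apply: rpredZ; rewrite Quotient.idealrBE reprK.
Qed.

Fact homology_scaleA c d a :
  homology_scale c (homology_scale d a) = homology_scale (c * d) a.
Proof. by elim/quotW: a => z; rewrite (pi_scale d z) !pi_scale scalerA. Qed.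

Fact homology_scale1 : left_id 1 homology_scale.
Proof. by move=> a; elim/quotW: a => z; rewrite pi_scale scale1r. Qed.

Fact homology_scaleDr : right_distributive homology_scale +%R.
Proof.
move=> c a b; elim/quotW: a => x; elim/quotW: b => y.
by rewrite (pi_scale c x) (pi_scale c y) -!pi_homologyD (pi_scale c) scalerDr.
Qed.

Fact homology_scaleDl a : {morph homology_scale^~ a : c d / c + d}.
Proof. by elim/quotW: a => z c d; rewrite !pi_scale scalerDl pi_homologyD. Qed.

HB.instance Definition _ := GRing.Zmodule_isLmodule.Build k homology
  homology_scaleA homology_scale1 homology_scaleDr homology_scaleDl.

(* The homology class of a cycle; the value [0] elsewhere is irrelevant. *)
Definition hclass (x : C i) : homology := \pi_homology (insubd (0 : cycles) x).
Definition hrepr (a : homology) : C i := val (repr a).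

Lemma hreprK : cancel hrepr hclass.
Proof. by move=> a; rewrite /hclass valKd reprK. Qed.

Lemma hrepr_cycle a : hrepr a \in is_cycle. Proof. exact: valP. Qed.

Lemma cycle_d (j : int) (e : i = j + 1) (x : C i) :
  (x \in is_cycle) = (cx_d C e x == 0).
Proof.
have ej : j = i - 1 by rewrite e addrK.
by subst j; rewrite unfold_in (eq_irrelevance (esym (subrK 1 i)) e).
Qed.

Lemma hclass_linear c : {in is_cycle &, forall x y,
  hclass (c *: x + y) = c *: hclass x + hclass y}.
Proof.
move=> x y cx cy; rewrite /hclass.
have -> : c *: hclass x = \pi_homology (c *: insubd (0 : cycles) x).
  exact: pi_scale.
rewrite -pi_homologyD; congr (\pi_homology _).
apply: val_inj; rewrite [RHS]linearP insubdK; last by rewrite rpredD ?rpredZ.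
by rewrite /= !insubdK.
Qed.

Lemma hclassZ c x : x \in is_cycle -> hclass (c *: x) = c *: hclass x.
Proof.
have hclass0 : hclass 0 = 0.
  have := @hclass_linear (-1) 0 0 (rpred0 _) (rpred0 _).
  by rewrite scaler0 addr0 scaleN1r addNr.
by move=> cx; rewrite -[c *: x]addr0 hclass_linear ?rpred0 // hclass0 addr0.
Qed.

Lemma hclass_boundary (j : int) (e : j = i + 1) (y : C j) :
  hclass (cx_d C e y) = 0.
Proof.
subst j; have cy : cx_d C (erefl (i + 1)) y \in is_cycle.
  by rewrite unfold_in cx_dd.
rewrite /hclass -[RHS](raddf0 \pi_homology); apply/eqP.
rewrite -[_ == _]Quotient.idealrBE subr0 unfold_in.
by apply/asboolP; exists y; rewrite /= insubdK.
Qed.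

Lemma hclass_eq (x y : C i) : x \in is_cycle -> y \in is_cycle ->
  hclass x = hclass y -> exists z, x - y = cx_d C (erefl (i + 1)) z.
Proof.
move=> cx cy /eqP; rewrite -[_ == _]Quotient.idealrBE => /asboolP[z].
by rewrite raddfB /= !insubdK // => <-; exists z.
Qed.

Lemma hclassP (a : homology) : exists2 x, x \in is_cycle & a = hclass x.
Proof. by exists (hrepr a); rewrite ?hrepr_cycle ?hreprK. Qed.

End Homology.

Arguments is_cycle {k} C i _.
Arguments is_boundary {k} C i _.

Definition homology_cx (k : fieldType) (C : complex k) : complex k.
Proof.
exists (fun i => homology C i : lmodType k)
  (fun i j _ => GRing.Linear.clone _ _ _ _ \0 _).
by [].
Defined.

Section HomologyMap.
Variables (k : fieldType) (C D : complex k) (f : chain_map C D).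

Definition hmap_fun i (a : homology C i) : homology D i :=
  hclass (f i (hrepr a)).

Lemma cm_cycle i x : x \in is_cycle C i -> f i x \in is_cycle D i.
Proof. by rewrite !unfold_in -cm_d => /eqP ->; rewrite linear0. Qed.

Lemma hmap_funE i x : x \in is_cycle C i -> hmap_fun (hclass x) = hclass (f i x).
Proof.
move=> cx; have cr := hrepr_cycle (hclass x).
have [z hz] := hclass_eq cr cx (hreprK _).
rewrite /hmap_fun -(subrK x (hrepr _)) hz addrC linearD cm_d.
rewrite -[f i x in LHS]scale1r hclass_linear ?cm_cycle //; last first.
  by rewrite unfold_in cx_dd.
by rewrite scale1r hclass_boundary addr0.
Qed.

Lemma hmap_fun_is_linear i : linear (@hmap_fun i).
Proof.
move=> c a b; have [x cx ->] := hclassP a; have [y cy ->] := hclassP b.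
rewrite -hclass_linear // !hmap_funE ?rpredD ?rpredZ //.
by rewrite linearP hclass_linear ?cm_cycle.
Qed.

HB.instance Definition _ i :=
  GRing.isLinear.Build k (homology C i) (homology D i) *:%R (@hmap_fun i)
    (@hmap_fun_is_linear i).

Definition hmap : chain_map (homology_cx C) (homology_cx D).
Proof.
exists (fun i => GRing.Linear.clone _ _ _ _ (@hmap_fun i) _).
by move=> i j e x; apply: linear0.
Defined.

Lemma hmapE i x : x \in is_cycle C i -> hmap i (hclass x) = hclass (f i x).
Proof. exact: hmap_funE. Qed.

End HomologyMap.

Section CircPerm.
Variables (l m n : nat) (e : (l + m = n)%N) (i : 'I_l.+1).
Variables (s : 'S_l.+1) (t : 'S_m.+1).

(* The inputs [i, ..., i + m] of a composite [x o_i y] are those of [y], the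
   other ones those of [x] except the [i]-th.  [circ_perm] acts as [t] on the
   former block, which it moves to the block of [s i], and as [s] elsewhere. *)
Definition circ_perm_fun (a : 'I_n.+1) : 'I_n.+1 :=
  if (i <= a <= i + m)%N then inord (s i + t (inord (a - i)))
  else let b := s (inord (if (a < i)%N then nat_of_ord a else a - m)%N) in
       inord (if (b < s i)%N then nat_of_ord b else b + m)%N.

Lemma circ_perm_inj : injective circ_perm_fun.
Proof.
have ub (u : 'S_l.+1) c : (u c < l.+1)%N by [].
have bt c : (t c < m.+1)%N by [].
have bi := ltn_ord i; have bsi := ub s i.
pose pr (c : 'I_n.+1) := nat_of_ord c.
have inS c d : (c < l.+1)%N -> (d < l.+1)%N ->
    s (inord c) = s (inord d) :> nat -> c = d.
  by move=> hc hd /val_inj/perm_inj/(congr1 val); rewrite /= !inordK.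
have inSi c : (c < l.+1)%N -> s (inord c) = s i :> nat -> c = i.
  by move=> hc /val_inj/perm_inj/(congr1 val); rewrite /= !inordK.
have inT c d : (c < m.+1)%N -> (d < m.+1)%N ->
    t (inord c) = t (inord d) :> nat -> c = d.
  by move=> hc hd /val_inj/perm_inj/(congr1 val); rewrite /= !inordK.
move=> a b; have ha := ltn_ord a; have hb := ltn_ord b.
rewrite /circ_perm_fun => E; apply: val_inj; move: (congr1 pr E) => {E}.
rewrite /pr /=.
have [ia|ia] := boolP (i <= a <= i + m)%N;
  have [ib|ib] := boolP (i <= b <= i + m)%N.
- have h1 := bt (inord (a - i)); have h2 := bt (inord (b - i)).
  rewrite !inordK; [|lia|lia] => H.
  have: t (inord (a - i)) = t (inord (b - i)) :> nat by lia.
  by move=> /inT; lia.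
- set cb := (if (b < i)%N then _ else _ : nat).
  have hc : (cb < l.+1)%N by rewrite /cb; case: ifP; lia.
  have ci : cb <> i by rewrite /cb; case: ifP; lia.
  have h1 := bt (inord (a - i)); have h2 := ub s (inord cb).
  have h3 : s (inord cb) <> s i :> nat by move/(inSi _ hc).
  by rewrite !inordK; do ?case: ifP; lia.
- set cb := (if (a < i)%N then _ else _ : nat).
  have hc : (cb < l.+1)%N by rewrite /cb; case: ifP; lia.
  have ci : cb <> i by rewrite /cb; case: ifP; lia.
  have h1 := bt (inord (b - i)); have h2 := ub s (inord cb).
  have h3 : s (inord cb) <> s i :> nat by move/(inSi _ hc).
  by rewrite !inordK; do ?case: ifP; lia.
- set ca := (if (a < i)%N then _ else _ : nat).
  set cb := (if (b < i)%N then _ else _ : nat).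
  have hca : (ca < l.+1)%N by rewrite /ca; case: ifP; lia.
  have hcb : (cb < l.+1)%N by rewrite /cb; case: ifP; lia.
  have cia : ca <> i by rewrite /ca; case: ifP; lia.
  have cib : cb <> i by rewrite /cb; case: ifP; lia.
  have h1 := ub s (inord ca); have h2 := ub s (inord cb).
  have h3 : s (inord ca) <> s i :> nat by move/(inSi _ hca).
  have h4 : s (inord cb) <> s i :> nat by move/(inSi _ hcb).
  move=> H; have : ca = cb.
    apply: inS => //; move: H.
    by rewrite !inordK; do ?case: ifP; lia.
  by rewrite /ca /cb; do !case: ifP; lia.
Qed.

Definition circ_perm : 'S_n.+1 := perm circ_perm_inj.

End CircPerm.

(* [P l] is the complex in arity [l + 1]; accordingly an [l]-indexed and an
   [m]-indexed operation compose to an [(l + m)]-indexed one, and the inputs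
   [1, ..., l + 1] are numbered from [0] by ['I_l.+1].
   The product [t * s] of permutations of the library applies [t] first: it is
   the usual composite of [s] after [t], so [op_actM] states that the action is
   a right one.  The [j]-th input of [op_act s x] is the [s j]-th one of [x]. *)
Record operad (k : fieldType) := Operad {
  op_cx :> nat -> complex k;
  op_act : forall l, 'S_l.+1 -> chain_map (op_cx l) (op_cx l);
  op_circ : forall l m n (p q r : int), (l + m = n)%N -> p + q = r ->
    'I_l.+1 -> op_cx l p -> op_cx m q -> op_cx n r;
  op_act1 : forall l i (x : op_cx l i), op_act 1%g i x = x;
  op_actM : forall l i (s t : 'S_l.+1) (x : op_cx l i),
    op_act (t * s)%g i x = op_act t i (op_act s i x);
  op_circ_linl : forall l m n (p q r : int) (e : (l + m = n)%N) (f : p + q = r)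
    (a : 'I_l.+1) (y : op_cx m q),
    linear (fun x : op_cx l p => op_circ e f a x y);
  op_circ_linr : forall l m n (p q r : int) (e : (l + m = n)%N) (f : p + q = r)
    (a : 'I_l.+1) (x : op_cx l p), linear (op_circ e f a x);
  op_circ_d : forall l m n (p q r p' q' r' : int)
    (e : (l + m = n)%N) (f : p + q = r) (f1 : p' + q = r') (f2 : p + q' = r')
    (hp : p = p' + 1) (hq : q = q' + 1) (hr : r = r' + 1)
    (a : 'I_l.+1) (x : op_cx l p) (y : op_cx m q),
    cx_d (op_cx n) hr (op_circ e f a x y) =
      op_circ e f1 a (cx_d (op_cx l) hp x) y
      + (-1) ^ p *: op_circ e f2 a x (cx_d (op_cx m) hq y);
  op_circ_seq : forall l m n lm mn lmn (p q r pq qr pqr : int)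
    (e1 : (l + m = lm)%N) (e2 : (lm + n = lmn)%N)
    (e3 : (m + n = mn)%N) (e4 : (l + mn = lmn)%N)
    (f1 : p + q = pq) (f2 : pq + r = pqr)
    (f3 : q + r = qr) (f4 : p + qr = pqr)
    (a : 'I_l.+1) (b : 'I_m.+1) (c : 'I_lm.+1)
    (x : op_cx l p) (y : op_cx m q) (z : op_cx n r),
    c = (a + b)%N :> nat ->
    op_circ e2 f2 c (op_circ e1 f1 a x y) z =
      op_circ e4 f4 a x (op_circ e3 f3 b y z);
  op_circ_par : forall l m n lm ln lmn (p q r pq pr pqr : int)
    (e1 : (l + m = lm)%N) (e2 : (lm + n = lmn)%N)
    (e3 : (l + n = ln)%N) (e4 : (ln + m = lmn)%N)
    (f1 : p + q = pq) (f2 : pq + r = pqr)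
    (f3 : p + r = pr) (f4 : pr + q = pqr)
    (a b : 'I_l.+1) (a' : 'I_ln.+1) (b' : 'I_lm.+1)
    (x : op_cx l p) (y : op_cx m q) (z : op_cx n r),
    (a < b)%N -> a' = a :> nat -> b' = (b + m)%N :> nat ->
    op_circ e2 f2 b' (op_circ e1 f1 a x y) z =
      (-1) ^ (q * r) *: op_circ e4 f4 a' (op_circ e3 f3 b x z) y;
  op_circ_act : forall l m n (p q r : int) (e : (l + m = n)%N) (f : p + q = r)
    (a : 'I_l.+1) (s : 'S_l.+1) (t : 'S_m.+1) (x : op_cx l p) (y : op_cx m q),
    op_circ e f a (op_act s p x) (op_act t q y) =
      op_act (circ_perm e a s t) r (op_circ e f (s a) x y)
}.

Arguments op_act {k} P {l} s : rename.
Arguments op_circ {k} P {l m n p q r} e f a x y : rename.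

Record operad_hom (k : fieldType) (P Q : operad k) := OperadHom {
  hom_fun :> forall l, chain_map (P l) (Q l);
  hom_act : forall l (i : int) (s : 'S_l.+1) (x : P l i),
    hom_fun l i (op_act P s i x) = op_act Q s i (hom_fun l i x);
  hom_circ : forall l m n (p q r : int) (e : (l + m = n)%N) (f : p + q = r)
    (a : 'I_l.+1) (x : P l p) (y : P m q),
    hom_fun n r (op_circ P e f a x y) =
      op_circ Q e f a (hom_fun l p x) (hom_fun m q y)
}.

Definition hom_eq (k : fieldType) (P Q : operad k) (f g : operad_hom P Q) :=
  forall l i, f l i =1 g l i.
Notation "f =h g" := (hom_eq f g) (at level 70, no associativity).

Section HomCategory.
Variable k : fieldType.

Definition hom_id (P : operad k) : operad_hom P P.
Proof. by exists (fun l => cm_id (P l)). Defined.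

Definition hom_comp (P Q R : operad k)
  (g : operad_hom Q R) (f : operad_hom P Q) : operad_hom P R.
Proof.
exists (fun l => cm_comp (g l) (f l)) => *.
- by rewrite /= !hom_act.
- by rewrite /= !hom_circ.
Defined.

Definition hom_inv (P Q : operad k) (f : operad_hom P Q)
  (bij_f : forall l i, bijective (f l i)) : operad_hom Q P.
Proof.
exists (fun l => cm_inv (bij_f l)) => /=.
- move=> l i s x; apply: (bij_inj (bij_f l i)).
  by rewrite hom_act !cm_inv_funK.
- move=> l m n p q r e h a x y; apply: (bij_inj (bij_f n r)).
  by rewrite hom_circ !cm_inv_funK.
Defined.

Definition automorphism (P : operad k) (f : operad_hom P P) :=
  exists g : operad_hom P P,
    hom_comp g f =h hom_id P /\ hom_comp f g =h hom_id P.

End HomCategory.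

Section HomologyOperad.
Variables (k : fieldType) (P : operad k).

Section Circ.
Variables (l m n : nat) (p q r : int) (e : (l + m = n)%N) (f : p + q = r).
Variable a : 'I_l.+1.

Lemma op_circ0l y : op_circ P e f a 0 y = 0.
Proof.
have /= := op_circ_linl e f a y (-1) 0 0.
by rewrite scaler0 addr0 scaleN1r addNr.
Qed.

Lemma op_circ0r x : op_circ P e f a x 0 = 0.
Proof.
have /= := op_circ_linr e f a x (-1) 0 0.
by rewrite scaler0 addr0 scaleN1r addNr.
Qed.

End Circ.

Section HCirc.
Variables (l m n : nat) (p q r : int) (e : (l + m = n)%N) (f : p + q = r).
Variable a : 'I_l.+1.

Definition hcirc (x : homology (P l) p) (y : homology (P m) q) :
    homology (P n) r :=
  hclass (op_circ P e f a (hrepr x) (hrepr y)).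

Lemma op_circ_cycle x y : x \in is_cycle (P l) p -> y \in is_cycle (P m) q ->
  op_circ P e f a x y \in is_cycle (P n) r.
Proof.
rewrite !unfold_in => /eqP dx /eqP dy.
have f1 : p - 1 + q = r - 1 by lia.
have f2 : p + (q - 1) = r - 1 by lia.
rewrite (op_circ_d e f f1 f2 (esym (subrK 1 p)) (esym (subrK 1 q))).
by rewrite dx dy op_circ0l op_circ0r scaler0 addr0.
Qed.

Lemma hclass_circl (z : P l (p + 1)) y : y \in is_cycle (P m) q ->
  hclass (op_circ P e f a (cx_d (P l) (erefl (p + 1)) z) y) = 0.
Proof.
rewrite unfold_in => /eqP dy.
have f0 : (p + 1) + q = r + 1 by lia.
have f2 : (p + 1) + (q - 1) = r by lia.
have := op_circ_d e f0 f f2 (erefl _) (esym (subrK 1 q)) (erefl _) a z y.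
by rewrite dy op_circ0r scaler0 addr0 => <-; rewrite hclass_boundary.
Qed.

Lemma hclass_circr x (w : P m (q + 1)) : x \in is_cycle (P l) p ->
  hclass (op_circ P e f a x (cx_d (P m) (erefl (q + 1)) w)) = 0.
Proof.
rewrite unfold_in => /eqP dx.
have f0 : p + (q + 1) = r + 1 by lia.
have f1 : (p - 1) + (q + 1) = r by lia.
have := op_circ_d e f0 f1 f (esym (subrK 1 p)) (erefl _) (erefl _) a x w.
rewrite dx op_circ0l add0r => /(congr1 (fun v => (-1) ^ (- p) *: v)).
rewrite scalerA -expfzDr ?oppr_eq0 ?oner_eq0 // addNr expr0z scale1r => <-.
by rewrite -linearZ hclass_boundary.
Qed.

Lemma hcircE x y : x \in is_cycle (P l) p -> y \in is_cycle (P m) q ->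
  hcirc (hclass x) (hclass y) = hclass (op_circ P e f a x y).
Proof.
move=> cx cy.
have cdz i (C : complex k) (z : C (i + 1)) :
    cx_d C (erefl (i + 1)) z \in is_cycle C i by rewrite unfold_in cx_dd.
have crx := hrepr_cycle (hclass x); have cry := hrepr_cycle (hclass y).
have [z hz] := hclass_eq crx cx (hreprK _).
have [w hw] := hclass_eq cry cy (hreprK _).
rewrite /hcirc -(subrK x (hrepr (hclass x))) hz -[_ z]scale1r.
rewrite op_circ_linl /= hclass_linear ?op_circ_cycle ?cdz //.
rewrite (hclass_circl z cry).
rewrite scaler0 add0r -(subrK y (hrepr (hclass y))) hw -[_ w]scale1r.
rewrite op_circ_linr /= hclass_linear ?op_circ_cycle ?cdz //.
rewrite (hclass_circr w cx).
by rewrite scaler0 add0r.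
Qed.

Lemma hcirc_linl y : linear (fun x => hcirc x y).
Proof.
move=> c x x'; have [z cz ->] := hclassP x; have [z' cz' ->] := hclassP x'.
have [w cw ->] := hclassP y; rewrite -hclass_linear // !hcircE //.
  by rewrite op_circ_linl hclass_linear ?op_circ_cycle.
by rewrite rpredD ?rpredZ.
Qed.

Lemma hcirc_linr x : linear (hcirc x).
Proof.
move=> c y y'; have [z cz ->] := hclassP y; have [z' cz' ->] := hclassP y'.
have [w cw ->] := hclassP x; rewrite -hclass_linear // !hcircE //.
  by rewrite op_circ_linr hclass_linear ?op_circ_cycle.
by rewrite rpredD ?rpredZ.
Qed.

Lemma hcirc0l y : hcirc 0 y = 0.
Proof.
have /= := hcirc_linl y (-1) 0 0.
by rewrite scaler0 addr0 scaleN1r addNr.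
Qed.

Lemma hcirc0r x : hcirc x 0 = 0.
Proof.
have /= := hcirc_linr x (-1) 0 0.
by rewrite scaler0 addr0 scaleN1r addNr.
Qed.

Lemma hcircZl c x y : hcirc (c *: x) y = c *: hcirc x y.
Proof. by have /= := hcirc_linl y c x 0; rewrite hcirc0l !addr0. Qed.

Lemma hcircZr c x y : hcirc x (c *: y) = c *: hcirc x y.
Proof. by have /= := hcirc_linr x c y 0; rewrite hcirc0r !addr0. Qed.

End HCirc.

Definition homology_operad : operad k.
Proof.
apply: (@Operad k (fun l => homology_cx (P l))
  (fun l s => hmap (op_act P s)) hcirc).
- move=> l i x; have [z cz ->] := hclassP x.
  by rewrite hmapE // op_act1.
- move=> l i s t x; have [z cz ->] := hclassP x.
  by rewrite !hmapE ?op_actM ?cm_cycle.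
- by move=> *; apply: hcirc_linl.
- by move=> *; apply: hcirc_linr.
- move=> l m n p q r p' q' r' e f f1 f2 ep eq er a x y.
  by rewrite /= hcirc0l hcirc0r scaler0 addr0.
- move=> l m n lm mn lmn p q r pq qr pqr e1 e2 e3 e4 f1 f2 f3 f4 a b c x y z.
  have [x' cx ->] := hclassP x; have [y' cy ->] := hclassP y.
  have [z' cz ->] := hclassP z => h; rewrite !hcircE ?op_circ_cycle //.
  by rewrite (op_circ_seq _ _ e3 e4 _ _ f3 f4 _ _ _ h).
- move=> l m n lm ln lmn p q r pq pr pqr e1 e2 e3 e4 f1 f2 f3 f4.
  move=> a b a' b' x y z.
  have [x' cx ->] := hclassP x; have [y' cy ->] := hclassP y.
  have [z' cz ->] := hclassP z => h ha hb; rewrite !hcircE ?op_circ_cycle //.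
  rewrite (op_circ_par _ _ e3 e4 _ _ f3 f4 _ _ _ h ha hb).
  by rewrite hclassZ ?op_circ_cycle.
- move=> l m n p q r e f a s t x y.
  have [x' cx ->] := hclassP x; have [y' cy ->] := hclassP y.
  rewrite hmapE //; rewrite hmapE //; rewrite hcircE ?cm_cycle //.
  by rewrite op_circ_act hcircE // hmapE ?op_circ_cycle.
Defined.
End HomologyOperad.

Lemma homology_actE (k : fieldType) (P : operad k) l i (s : 'S_l.+1) x :
  x \in is_cycle (P l) i ->
  op_act (homology_operad P) s i (hclass x) = hclass (op_act P s i x).
Proof. exact: hmapE. Qed.

Lemma homology_circE (k : fieldType) (P : operad k) l m n (p q r : int)
    (e : (l + m = n)%N) (f : p + q = r) a x y :
  x \in is_cycle (P l) p -> y \in is_cycle (P m) q ->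
  op_circ (homology_operad P) e f a (hclass x) (hclass y) =
    hclass (op_circ P e f a x y).
Proof. exact: hcircE. Qed.

Definition homology_hom (k : fieldType) (P Q : operad k) (f : operad_hom P Q) :
  operad_hom (homology_operad P) (homology_operad Q).
Proof.
exists (fun l => hmap (f l)).
- move=> l i s x; have [z cz ->] := hclassP x.
  have cfz := cm_cycle (f l) cz; have csz := cm_cycle (op_act P s) cz.
  rewrite (homology_actE s cz) (hmapE (f l) cz) (hmapE (f l) csz).
  by rewrite (homology_actE s cfz) hom_act.
- move=> l m n p q r e h a x y.
  have [x' cx ->] := hclassP x; have [y' cy ->] := hclassP y.
  have cfx := cm_cycle (f l) cx; have cfy := cm_cycle (f m) cy.
  rewrite (homology_circE e h a cx cy) (hmapE (f l) cx) (hmapE (f m) cy).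
  rewrite (homology_circE e h a cfx cfy) -hom_circ.
  exact/hmapE/op_circ_cycle.
Defined.

Definition grading_cm (k : fieldType) (C : complex k) (alpha : k) :
  chain_map (homology_cx C) (homology_cx C).
Proof.
exists (fun i => GRing.Linear.clone _ _ _ _ ( *:%R (alpha ^ i)) _).
by move=> i j e x; apply: scaler0.
Defined.

Definition grading_aut (k : fieldType) (P : operad k) (alpha : k)
  (alpha0 : alpha != 0) : operad_hom (homology_operad P) (homology_operad P).
Proof.
exists (fun l => grading_cm (P l) alpha).
- by move=> l i s x; apply/esym/linearZ.
- move=> l m n p q r e f a x y.
  transitivity (alpha ^ r *: hcirc e f a x y); first by [].
  transitivity (hcirc e f a (alpha ^ p *: x) (alpha ^ q *: y)); last by [].
  have -> : alpha ^ r = alpha ^ p * alpha ^ q by rewrite -f expfzDr.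
  by rewrite hcircZl hcircZr scalerA.
Defined.

Definition weak_equivalence (k : fieldType) (P Q : operad k)
  (f : operad_hom P Q) := forall l i, bijective (homology_hom f l i).

Inductive zigzag (k : fieldType) : operad k -> operad k -> Type :=
| ZigNil P : zigzag P P
| ZigFwd P Q R (f : operad_hom P Q) :
    weak_equivalence f -> zigzag Q R -> zigzag P R
| ZigBwd P Q R (f : operad_hom Q P) :
    weak_equivalence f -> zigzag Q R -> zigzag P R.

Fixpoint zigzag_hom (k : fieldType) (P Q : operad k) (z : zigzag P Q) :
    operad_hom (homology_operad P) (homology_operad Q) :=
  match z with
  | ZigNil P => hom_id (homology_operad P)
  | ZigFwd _ _ _ f _ z' => hom_comp (zigzag_hom z') (homology_hom f)
  | ZigBwd _ _ _ f wf z' => hom_comp (zigzag_hom z') (hom_inv wf)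
  end.

Lemma zigzag_hom_bij (k : fieldType) (P Q : operad k) (z : zigzag P Q) l i :
  bijective (zigzag_hom z l i).
Proof.
elim: z => [{}P|{}P {}Q R f wf z IH|{}P {}Q R f wf z IH] /=.
- exact: (Bijective (g := id)).
- exact: bij_comp IH (wf l i).
- apply: bij_comp IH _; have := cm_inv_funK (wf l) (i := i) => fK.
  by apply: (bij_can_bij (wf l i)) => x; apply: (bij_inj (wf l i)); rewrite fK.
Qed.

(* [P'] is a model of [P] when there is some [z : zigzag P' P]; [H_along z f]
   is [H f] seen on [HP] through the identification of [HP'] with [HP] given
   by [z]. *)
Definition H_along (k : fieldType) (P' P : operad k) (z : zigzag P' P)
    (f : operad_hom P' P') :
    operad_hom (homology_operad P) (homology_operad P) :=
  hom_comp (zigzag_hom z)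
    (hom_comp (homology_hom f) (hom_inv (zigzag_hom_bij z))).

Definition weakly_equivalent (k : fieldType) (P Q : operad k) :=
  inhabited (zigzag P Q).

Definition formal (k : fieldType) (P : operad k) :=
  weakly_equivalent P (homology_operad P).

Definition findim (k : fieldType) (V : lmodType k) :=
  exists (n : nat) (b : 'I_n -> V),
    forall v, exists c : 'rV[k]_n, v = \sum_j c 0 j *: b j.

(* The total space of a graded vector space is finite dimensional when every
   component is so and all but finitely many of them are zero. *)
Definition homology_of_finite_type (k : fieldType) (P : operad k) :=
  forall l, (forall i, findim (homology_operad P l i)) /\
    exists N : nat, forall i (x : homology_operad P l i), (N < `|i|)%N -> x = 0.

Definition is_basis (k : fieldType) (V : lmodType k) n (b : 'I_n -> V) :=
  forall v, exists! c : 'rV[k]_n, v = \sum_j c 0 j *: b j.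

(* A morphism [Gamma -> Z] from a subgroup [Gamma] of the units; the values of
   [wt] outside [Gamma] are irrelevant. *)
Record weight_function (K : fieldType) := WeightFunction {
  wt_dom : K -> Prop;
  wt :> K -> int;
  wt_dom_neq0 : forall x, wt_dom x -> x != 0;
  wt_dom1 : wt_dom 1;
  wt_domM : forall x y, wt_dom x -> wt_dom y -> wt_dom (x * y);
  wt_domV : forall x, wt_dom x -> wt_dom x^-1;
  wtM : forall x y, wt_dom x -> wt_dom y -> wt (x * y) = wt x + wt y
}.

Section Purity.
Variables (k : fieldType) (K : fieldType) (iota : {rmorphism k -> K}).

(* The characteristic polynomial is computed on a basis; the roots are taken in
   [K], which will be an algebraic closure of [k]. *)
Definition pure (w : weight_function K) (n : int) (V : lmodType k)
    (f : {linear V -> V}) :=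
  exists (m : nat) (b : 'I_m -> V) (A : 'M[k]_m),
    [/\ is_basis b, forall j, f (b j) = \sum_i A i j *: b i
      & forall x, root (map_poly iota (char_poly A)) x ->
          wt_dom w x /\ w x = n].

Definition pure_endomorphism (w : weight_function K) (P : operad k)
    (f : operad_hom P P) :=
  forall l i, pure w i (homology_hom f l i).

End Purity.

(* Main.v *)
(* The implication from (4) to (1) rests on a functorial weight decomposition up
   to homotopy.  Let [f] be a pure endomorphism of [P] and let [C_n] be the space
   of sequences in [k] that satisfy a linear recurrence whose characteristic
   roots have weight at most [n]; pointwise products map [C_n * C_m] to
   [C_(n + m)].  Let [W_n] consist of the sequences [(p_j)] of polynomial paths in
   [P], with coefficients in [C_n] as functions of [j], such that
   [f (p_j 0) = p_(j+1) 1]: a homotopy version of the generalized eigenspaces of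
   [f] of weight at most [n].  Polynomial differential forms being strictly
   commutative in characteristic zero, the [W_n] form a filtered operad.  Since
   [f] is pure, evaluation [p |-> p_0 0] identifies [H_i W_n] with [H_i P] for
   [i <= n], and [H_i W_n = 0] for [i > n].  Hence the suboperad
   [T_i = {u in W_i | d u in W_(i-1)}] has homology [H P], and modulo [W_(i-1)]
   every element of [T_i] is a cycle; sending it to the class of that cycle is a
   weak equivalence from [T] to [H P]. *)

From HB Require Import structures.
Require Import Defs.
From mathcomp Require Import all_boot all_order all_algebra all_fingroup.
From mathcomp Require Import ring zify boolp functions.

Set Implicit Arguments.
Unset Strict Implicit.
Unset Printing Implicit Defensive.

Import Order.TTheory GRing.Theory Num.Theory.
Local Open Scope ring_scope.

(** * Linearly recurrent sequences *)

(** On a complex of infinite dimension [f] need not have a Jordan decomposition, and an eigenclass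
    in homology lifts to an eigenvector only up to boundaries. Following orbits cures the first
    defect: a generalized eigenvector becomes the recurrent sequence of its iterates. Paths cure the
    second. Thus [W_n] is the homotopy kernel of the shift minus [f] on sequences with coefficients
    in [C_n], and its homology is governed by the kernel and the cokernel of the same map on
    homology. The vanishing statements come from the coprimality of polynomials whose roots have
    different weights. Polynomial forms are stored through their values: [t |-> t + eta],
    [dt |-> eps] is a morphism of dg algebras to a small algebra, so the operad axioms hold
    pointwise in [(j, t)]. The price is that a polynomial must be recovered from its values, which
    characteristic zero permits. Products of sequences are controlled by products of roots, which
    lie in [K], whereas the sequences have values in [k]; hence a descent of recurrences from [K] to
    [k]. *)

Section Recurrent.
Variable k : fieldType.
Implicit Types (M N : lmodType k) (g h u v : {poly k}).

(* A sequence [c] is the same thing as the linear map ['X^j |-> c j] on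
   polynomials, which turns the shift into multiplication by ['X]. *)
Definition seq_eval M (c : nat -> M) h : M := \sum_(m < size h) h`_m *: c m.

Lemma seq_eval_widen M (c : nat -> M) n h : (size h <= n)%N ->
  seq_eval c h = \sum_(m < n) h`_m *: c m.
Proof.
move=> hn; rewrite /seq_eval (big_ord_widen _ (fun m => h`_m *: c m) hn).
rewrite big_mkcond; apply: eq_bigr => m _; case: ifPn => //.
by rewrite -leqNgt => hm; rewrite nth_default // scale0r.
Qed.

Lemma seq_eval_is_linear M (c : nat -> M) : linear (seq_eval c).
Proof.
move=> a g h; pose n := maxn (size g) (size h).
have sg : (size g <= n)%N by rewrite leq_maxl.
have sh : (size h <= n)%N by rewrite leq_maxr.
have sgh : (size (a *: g + h)%R <= n)%N.
  apply: leq_trans (size_polyD _ _) _.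
  by rewrite geq_max sh (leq_trans (size_scale_leq _ _)).
rewrite (seq_eval_widen c sg) (seq_eval_widen c sh) (seq_eval_widen c sgh).
rewrite scaler_sumr -big_split /=; apply: eq_bigr => m _.
by rewrite coefD coefZ scalerDl scalerA.
Qed.

HB.instance Definition _ M c :=
  GRing.isLinear.Build k {poly k} M *:%R (@seq_eval M c) (seq_eval_is_linear c).

Lemma seq_evalXn M (c : nat -> M) j : seq_eval c 'X^j = c j.
Proof.
rewrite (seq_eval_widen c (n := j.+1)) ?size_polyXn // big_ord_recr /=.
rewrite coefXn eqxx scale1r big1 ?add0r // => m _.
by rewrite coefXn ltn_eqF // scale0r.
Qed.

Lemma seq_eval_ext M (phi : {poly k} -> M) c : linear phi ->
  (forall j, phi 'X^j = c j) -> phi =1 seq_eval c.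
Proof.
move=> lphi hc h.
have phi0 : phi 0 = 0.
  by have := lphi (-1) 0 0; rewrite scaler0 addr0 scaleN1r addNr.
rewrite -[h in phi h]coefK poly_def /seq_eval.
elim: (size h) => [|n IH]; first by rewrite !big_ord0.
by rewrite !big_ord_recr /= addrC lphi IH hc addrC.
Qed.

Lemma seq_eval_mul M (c : nat -> M) g h :
  seq_eval c (h * g) = seq_eval (fun j => seq_eval c ('X^j * g)) h.
Proof.
apply: (seq_eval_ext (phi := fun h => seq_eval c (h * g))) => // a x y.
by rewrite mulrDl -scalerAl linearP.
Qed.

Lemma seq_eval_map M N (phi : M -> N) (c : nat -> M) h : linear phi ->
  seq_eval (phi \o c) h = phi (seq_eval c h).
Proof.
move=> lphi; apply/esym/(seq_eval_ext (phi := phi \o seq_eval c)) => [a x y|j] /=.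
  by rewrite linearP lphi.
by rewrite seq_evalXn.
Qed.

Lemma seq_eval_shift M (c : nat -> M) h :
  seq_eval (fun j => c j.+1) h = seq_eval c (h * 'X).
Proof.
apply/esym/(seq_eval_ext (phi := fun h => seq_eval c (h * 'X))) => [a x y|j].
  by rewrite mulrDl -scalerAl linearP.
by rewrite -exprSr seq_evalXn.
Qed.

Lemma seq_eval_lin M a (c d : nat -> M) h :
  seq_eval (fun j => a *: c j + d j) h = a *: seq_eval c h + seq_eval d h.
Proof.
rewrite /seq_eval scaler_sumr -big_split; apply: eq_bigr => m _ /=.
by rewrite scalerDr !scalerA mulrC.
Qed.

Definition killed g M (c : nat -> M) := forall h, seq_eval c (h * g) = 0.

Lemma seq_eval0 M h : seq_eval (fun=> 0 : M) h = 0.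
Proof. by rewrite /seq_eval big1 // => m _; rewrite scaler0. Qed.

Lemma killedP g M (c : nat -> M) :
  (forall j, seq_eval c ('X^j * g) = 0) -> killed g c.
Proof.
move=> hc h; rewrite seq_eval_mul.
by under eq_fun do rewrite hc; apply: seq_eval0.
Qed.

Lemma killed_ext g M (c d : nat -> M) : c =1 d -> killed g c -> killed g d.
Proof. by move=> /funext ->. Qed.

Lemma killed0 g M : killed g (fun=> 0 : M).
Proof. by move=> h; apply: seq_eval0. Qed.

Lemma killed_mull g h M (c : nat -> M) : killed g c -> killed (h * g) c.
Proof. by move=> hc u; rewrite mulrA. Qed.

Lemma killed_mulr g h M (c : nat -> M) : killed g c -> killed (g * h) c.
Proof. by rewrite mulrC; apply: killed_mull. Qed.

Lemma killed_lin g M a (c d : nat -> M) : killed g c -> killed g d ->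
  killed g (fun j => a *: c j + d j).
Proof. by move=> hc hd h; rewrite seq_eval_lin hc hd scaler0 addr0. Qed.

Lemma killedD g M (c d : nat -> M) : killed g c -> killed g d ->
  killed g (fun j => c j + d j).
Proof.
move=> hc hd; apply: killed_ext (killed_lin 1 hc hd) => j.
by rewrite scale1r.
Qed.

Lemma killedZ g M a (c : nat -> M) : killed g c -> killed g (fun j => a *: c j).
Proof.
move=> hc; apply: killed_ext (killed_lin a hc (killed0 g M)) => j.
by rewrite addr0.
Qed.

Lemma killedB g M (c d : nat -> M) : killed g c -> killed g d ->
  killed g (fun j => c j - d j).
Proof.
move=> hc /(killedZ (-1)) hd; apply: killed_ext (killedD hc hd) => j.
by rewrite scaleN1r.
Qed.

Lemma killed_map g M N (phi : M -> N) (c : nat -> M) : linear phi ->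
  killed g c -> killed g (phi \o c).
Proof.
move=> lphi hc h; rewrite seq_eval_map // hc.
by have := lphi (-1) 0 0; rewrite scaler0 addr0 scaleN1r addNr.
Qed.

Lemma killed_shift g M (c : nat -> M) : killed g c -> killed g (fun j => c j.+1).
Proof. by move=> hc h; rewrite seq_eval_shift mulrAC. Qed.

(** The Bezout coefficient [v] inverts ['X] modulo [g], so the recurrence also runs backwards by one
    step. Weights are defined on units, so every polynomial with a weight bound qualifies. *)
Lemma killed_unshift g M (c : nat -> M) : g != 0 -> ~~ root g 0 ->
  killed g c -> exists2 d : nat -> M, killed g d & forall j, d j.+1 = c j.
Proof.
move=> g0 r0 hc.
have /Bezout_eq1_coprimepP[[u v] /= huv] : coprimep g 'X by rewrite coprimepX.
exists (fun j => seq_eval c ('X^j * v)).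
  by move=> h; rewrite -seq_eval_mul mulrAC.
move=> j; have -> : 'X^(j.+1) * v = 'X^j - 'X^j * u * g.
  by rewrite -[X in _ = X - _]mulr1 -huv exprSr; ring.
by rewrite linearB /= hc subr0 seq_evalXn.
Qed.

Lemma killed_coprime g h M (c : nat -> M) : coprimep g h ->
  killed g c -> killed h c -> forall j, c j = 0.
Proof.
move=> /Bezout_eq1_coprimepP[[u v] /= huv] hg hh j.
by rewrite -seq_evalXn -[_^+j]mulr1 -huv mulrDr !mulrA linearD /= hg hh addr0.
Qed.

(* The solution of the recurrence [g] with initial values the [m]-th unit vector. *)
Definition fund_sol g (m j : nat) : k := ('X^j %% g)`_m.

Lemma seq_eval_fund_sol g (m : nat) h :
  seq_eval (fund_sol g m : nat -> k^o) h = (h %% g)`_m.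
Proof.
apply/esym/(seq_eval_ext (phi := (fun h => (h %% g)`_m) : _ -> k^o)) => // a x y.
by rewrite modpD modpZl coefD coefZ.
Qed.

Lemma killed_fund_sol g m : killed g (fund_sol g m : nat -> k^o).
Proof. by move=> h; rewrite seq_eval_fund_sol modp_mull coef0. Qed.

(** Reducing ['X^j] modulo [g] expresses the term [c j] by the initial values: solutions in [M] are
    finite sums of scalar solutions times vectors. *)
Lemma killed_fund_solE g M (c : nat -> M) : g != 0 -> killed g c ->
  forall j, c j = \sum_(m < size g) fund_sol g m j *: c m.
Proof.
move=> g0 hc j; rewrite -seq_evalXn [in LHS](divp_eq 'X^j g) linearD /= hc add0r.
by rewrite (seq_eval_widen c (ltnW (ltn_modpN0 _ g0))).
Qed.

Lemma killed_sum g M n (e : nat -> nat -> k^o) (x : nat -> M) :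
  (forall m, killed g (e m)) ->
  killed g (fun j => \sum_(m < n) e m j *: x m).
Proof.
move=> he; elim: n => [|n IH].
  by apply: killed_ext (killed0 g M) => j; rewrite big_ord0.
apply: killed_ext (killedD IH (killed_map (phi := fun a : k^o => a *: x n) _ (he n))).
  by move=> j; rewrite big_ord_recr.
by move=> a u v; rewrite scalerDl -scalerA.
Qed.

(** Lifting term by term would destroy the recurrence; only the initial terms are lifted, and
    [fund_sol g] propagates them. *)
Lemma killed_lift g M N (phi : M -> N) (c : nat -> N) : linear phi -> g != 0 ->
  killed g c -> (forall j, exists x, phi x = c j) ->
  exists2 d : nat -> M, killed g d & forall j, phi (d j) = c j.
Proof.
move=> lphi g0 hc /choice[x hx].
exists (fun j => \sum_(m < size g) fund_sol g m j *: x m).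
  by apply: killed_sum => m; apply: killed_fund_sol.
have phi0 : phi 0 = 0.
  by have := lphi (-1) 0 0; rewrite scaler0 addr0 scaleN1r addNr.
move=> j; rewrite (killed_fund_solE g0 hc) (big_morph phi (id1 := 0) (op1 := +%R)) //.
  apply: eq_bigr => m _; rewrite -hx.
  by have := lphi (fund_sol g m j) (x m) 0; rewrite phi0 !addr0.
by move=> a b; have := lphi 1 a b; rewrite !scale1r.
Qed.

(** On an orbit the shift acts as [phi], so a polynomial in the shift acts as the same polynomial in
    [phi]. *)
Lemma seq_eval_iter M (phi : M -> M) (x : M) h : linear phi ->
  forall j, seq_eval (fun j => iter j phi x) ('X^j * h) =
            iter j phi (seq_eval (fun j => iter j phi x) h).
Proof.
move=> lphi; elim=> [|j IH]; first by rewrite mul1r.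
rewrite iterS -IH -seq_eval_map // exprSr -mulrA (mulrC 'X) mulrA -seq_eval_shift.
by congr (seq_eval _ _).
Qed.

(* The cokernel of [shift - phi] vanishes on sequences killed by [g] when [g]
   is prime to the annihilator [chi] of [phi]. *)
Lemma killed_solve g chi M (phi : M -> M) (b : nat -> M) : linear phi ->
  coprimep g chi -> (forall x, killed chi (fun j => iter j phi x)) ->
  killed g b ->
  exists2 c : nat -> M, killed g c & forall j, c j.+1 - phi (c j) = b j.
Proof.
move=> lphi /Bezout_eq1_coprimepP[[u v] /= huv] hchi hb.
pose o x j := iter j phi x.
(* [c0] solves the equation from the initial value 0 but need not be killed by [g]. Its defect [e]
   is an orbit of [phi], because [g] kills [b]. *)
pose c0 := fix c0 j := if j is j'.+1 then phi (c0 j') + b j' else 0.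
pose e j := seq_eval c0 ('X^j * g).
have eS j : e j.+1 = phi (e j).
  rewrite /e exprSr -mulrA (mulrC 'X) mulrA -seq_eval_shift.
  have -> : (fun j => c0 j.+1) = (fun j => 1 *: (phi \o c0) j + b j).
    by apply/funext => i; rewrite scale1r.
  by rewrite seq_eval_lin hb addr0 scale1r seq_eval_map.
have eo j : e j = o (e 0) j by elim: j => //= j IH; rewrite eS IH.
(* Adding an orbit of [phi] preserves the equation. The orbit of [x] has defect [e], since [u]
   inverts [g] modulo [chi] and [chi] annihilates orbits. *)
pose x := seq_eval (o (e 0)) u.
have ox j : seq_eval (o x) ('X^j * g) = e j.
  rewrite /o seq_eval_iter //.
  have -> : seq_eval (o x) g = seq_eval (o (e 0)) (g * u).
    rewrite seq_eval_mul; congr (seq_eval _ _); apply/funext => i.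
    by rewrite [RHS]seq_eval_iter.
  rewrite mulrC; have -> : u * g = 1 - v * chi by rewrite -huv addrK.
  by rewrite linearB /= hchi subr0 eo -[X in seq_eval _ X](expr0 'X) seq_evalXn.
exists (fun j => (-1) *: o x j + c0 j).
  by apply: killedP => j; rewrite seq_eval_lin ox scaleN1r addNr.
move=> j; rewrite lphi /= !scaleN1r.
by rewrite opprD addrACA subrr add0r addrAC subrr add0r.
Qed.

End Recurrent.

(** * Products of recurrent sequences and descent to the base field *)

Section SequenceProducts.
Variables (k : fieldType) (K : closedFieldType) (iota : {rmorphism k -> K}).
Variable w : weight_function K.

Definition weight_le (n : int) (g : {poly K}) :=
  g != 0 /\ forall x, root g x -> wt_dom w x /\ w x <= n.

Lemma weight_leM n g h : weight_le n g -> weight_le n h -> weight_le n (g * h).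
Proof.
move=> [g0 hg] [h0 hh]; split; first by rewrite mulf_neq0.
by move=> x; rewrite rootM => /orP[/hg|/hh].
Qed.

Lemma weight_leW n m g : n <= m -> weight_le n g -> weight_le m g.
Proof.
move=> nm [g0 hg]; split=> // x /hg[dx wx]; split=> //; exact: le_trans nm.
Qed.

Lemma weight_le_root0 n (g : {poly k}) :
  weight_le n (map_poly iota g) -> ~~ root g 0.
Proof.
move=> [_ hg]; apply/negP => r0.
have /hg[/wt_dom_neq0] : root (map_poly iota g) 0.
  by rewrite -(rmorph0 iota) fmorph_root.
by rewrite eqxx.
Qed.

Lemma weight_le_neq0 n (g : {poly k}) : weight_le n (map_poly iota g) -> g != 0.
Proof. by case; rewrite map_poly_eq0. Qed.

Lemma killed_XsubC (F : fieldType) (l : F) (g : {poly F}) (a : nat -> F^o) :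
  killed (('X - l%:P) * g) a <->
  killed g (fun j => (- l) *: a j + a j.+1 : F^o).
Proof.
have E h : seq_eval (fun j => (- l) *: a j + a j.+1 : F^o) h =
    seq_eval a (h * ('X - l%:P)).
  rewrite seq_eval_lin seq_eval_shift mulrBr linearB /= addrC scaleNr.
  by rewrite (mulrC h l%:P) mul_polyC (linearZ _ h).
split=> H h; first by rewrite E -mulrA (mulrC g).
by rewrite (mulrC _ g) mulrA -E.
Qed.

(** Induction on the total number of roots: [a_(j+1) b_(j+1) - x y a_j b_j] equals [(a_(j+1) - x
    a_j) b_(j+1) + x a_j (b_(j+1) - y b_j)], and each summand is a product with one root fewer. The
    new root [x y] has weight at most [n + m]. *)
Lemma killed_mul_roots (r s : seq K) n m (a b : nat -> K^o) :
  (forall x, x \in r -> wt_dom w x /\ w x <= n) ->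
  (forall x, x \in s -> wt_dom w x /\ w x <= m) ->
  killed (\prod_(x <- r) ('X - x%:P)) a ->
  killed (\prod_(x <- s) ('X - x%:P)) b ->
  exists2 g, weight_le (n + m) g & killed g (fun j => a j * b j : K^o).
Proof.
have [p] := ubnP (size r + size s).
elim: p r s a b => // p IH [|x r] s a b.
  move=> _ _ _ ha _; exists 1.
    by split=> [|y]; rewrite ?oner_neq0 ?(negPf (root1 _)).
  apply: killed_ext (killed0 _ _) => j; rewrite big_nil in ha.
  by have := ha 'X^j; rewrite mulr1 seq_evalXn => ->; rewrite mul0r.
case: s => [|y s].
  move=> _ _ _ _ hb; exists 1.
    by split=> [|z]; rewrite ?oner_neq0 ?(negPf (root1 _)).
  apply: killed_ext (killed0 _ _) => j; rewrite big_nil in hb.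
  by have := hb 'X^j; rewrite mulr1 seq_evalXn => ->; rewrite mulr0.
move=> hp hr hs ha hb.
have [hx1 hx2] := hr x (mem_head _ _); have [hy1 hy2] := hs y (mem_head _ _).
have hr' z : z \in r -> wt_dom w z /\ w z <= n.
  by move=> zr; apply: hr; rewrite in_cons zr orbT.
have hs' z : z \in s -> wt_dom w z /\ w z <= m.
  by move=> zs; apply: hs; rewrite in_cons zs orbT.
rewrite /= in hp.
have ha' := ha; have hb' := hb.
rewrite big_cons in ha'; move/killed_XsubC in ha'.
rewrite big_cons in hb'; move/killed_XsubC in hb'.
have [|g1 w1 k1] := IH r (y :: s) _ _ _ hr' hs ha' (killed_shift hb).
  by rewrite /=; lia.
have [|g2 w2 k2] := IH (x :: r) s _ _ _ hr hs' (killedZ x ha) hb'.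
  by rewrite /=; lia.
exists (('X - (x * y)%:P) * (g1 * g2)).
  apply: weight_leM; last exact: weight_leM.
  split=> [|z]; first by rewrite polyXsubC_eq0.
  rewrite root_XsubC => /eqP ->; split; first exact: wt_domM.
  by rewrite wtM // lerD.
apply/killed_XsubC.
apply: killed_ext (killedD (killed_mulr g2 k1) (killed_mull g1 k2)) => j.
by rewrite /GRing.scale /=; ring.
Qed.

Lemma killed_mul_weight n m (g h : {poly K}) (a b : nat -> K^o) :
  weight_le n g -> weight_le m h -> killed g a -> killed h b ->
  exists2 u, weight_le (n + m) u & killed u (fun j => a j * b j : K^o).
Proof.
have norm p q (c : nat -> K^o) : weight_le p q -> killed q c ->
    exists r : seq K, (forall x, x \in r -> wt_dom w x /\ w x <= p) /\
      killed (\prod_(x <- r) ('X - x%:P)) c.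
  move=> [q0 hq] qc; have [r hr] := closed_field_poly_normal q.
  have l0 : lead_coef q != 0 by rewrite lead_coef_eq0.
  move: (lead_coef q) l0 hr => l l0 hr; exists r; split=> [x xr|v].
    by apply: hq; rewrite hr rootZ // root_prod_XsubC.
  have := qc (l^-1 *: v).
  by rewrite hr -scalerAl -scalerAr scalerA mulVf // scale1r.
move=> wg wh ga hb; have [r [hr ka]] := norm _ _ _ wg ga.
have [s [hs kb]] := norm _ _ _ wh hb.
exact: killed_mul_roots ka kb.
Qed.

Lemma killed_vanish (F : fieldType) (g : {poly F}) (e : nat -> F^o) : g != 0 ->
  killed g e -> (forall j, (j < (size g).-1)%N -> e j = 0) ->
  forall j, e j = 0.
Proof.
move=> g0 ke he j; rewrite -seq_evalXn (divp_eq 'X^j g) linearD /= ke add0r.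
rewrite /seq_eval big1 // => m _; rewrite he ?scaler0 //.
have := ltn_modpN0 'X^j g0; have := ltn_ord m.
by case: (size g) => [|d] /=; [lia | move=> h1 h2; apply: leq_trans h1 _].
Qed.

(* A recurrence over [K] of minimal order satisfied by a sequence in [k] is
   the unique solution of a linear system with coefficients in [k]. *)
Lemma killed_descent n (G : {poly K}) (a : nat -> k) : weight_le n G ->
  killed G (fun j => iota (a j) : K^o) ->
  exists2 g : {poly k}, weight_le n (map_poly iota g) & killed g (a : nat -> k^o).
Proof.
pose a' := (fun j => iota (a j)) : nat -> K^o => wG kG.
pose Q d := `[< exists2 H : {poly K}, H != 0 & (size H).-1 = d /\ killed H a' >].
have exQ : exists d, Q d.
  by exists (size G).-1; apply/asboolP; exists G; rewrite ?wG.1.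
case: (ex_minnP exQ) => d /asboolP[H H0 [sH kH]] dmin.
have sH1 : size H = d.+1 by rewrite -sH prednK // size_poly_gt0.
(* The rows [R j] are the windows of length [d] of the sequence, so [B] is a Hankel matrix. *)
pose R j := \row_(t < d) a (j + t)%N.
pose B := \matrix_(i < d) R i.
have sub : (R d <= B)%MS.
  (* Membership in a row space is insensitive to field extension, and over [K] the coefficients of
     [H] provide the combination. *)
  rewrite -(map_submx iota).
  have l0 : lead_coef H != 0 by rewrite lead_coef_eq0.
  apply/submxP; exists (\row_(j < d) (- (lead_coef H)^-1 * H`_j)).
  apply/rowP => t; rewrite !mxE.
  have := kH 'X^t; rewrite mulrC seq_eval_mul.
  under eq_fun do rewrite -exprD seq_evalXn.
  rewrite /seq_eval sH1 big_ord_recr /= => /eqP.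
  rewrite addr_eq0 => /eqP E.
  under eq_bigr do rewrite !mxE -mulrA.
  rewrite -mulr_sumr -[X in _ * X]/(\sum_(i < d) H`_i *: a' (i + t)%N) E.
  rewrite mulrNN lead_coefE sH -[_ *: _]/(H`_d * _) mulrA mulVf ?mul1r //.
  by rewrite -sH -lead_coefE.
have [u Eu] := submxP sub.
pose g := 'X^d - \sum_(j < d) u 0 j *: 'X^j.
have sg : size g = d.+1.
  rewrite /g size_polyDl size_polyXn // size_polyN ltnS.
  apply: leq_trans (size_sum _ _ _) _; apply/bigmax_leqP => j _.
  by apply: leq_trans (size_scale_leq _ _) _; rewrite size_polyXn.
have g0 : g != 0 by rewrite -size_poly_gt0 sg.
have mg0 : map_poly iota g != 0 by rewrite map_poly_eq0.
have evE h : seq_eval a' (map_poly iota h) = iota (seq_eval (a : nat -> k^o) h).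
  rewrite /seq_eval size_map_poly rmorph_sum; apply: eq_bigr => m _.
  by rewrite coef_map -[X in _ = iota X]/(_ * _) rmorphM.
have kg : killed g (a : nat -> k^o).
  apply: killedP => j; apply: (fmorph_inj iota).
  rewrite -evE rmorphM rmorph0 /= map_polyXn.
  (* The defect of [g] obeys the recurrence [H] of order [d], and its first [d] terms vanish by the
     choice of [u]. *)
  apply: (killed_vanish (e := fun j => seq_eval a' ('X^j * map_poly iota g)) H0).
    by move=> h; rewrite -seq_eval_mul -mulrA (mulrC H) mulrA kH.
  move=> t; rewrite sH => td /=.
  rewrite -(map_polyXn iota) -rmorphM /= evE -(rmorph0 iota); congr (iota _).
  rewrite mulrBr linearB /= -exprD seq_evalXn addnC.
  have := congr1 (fun A : 'rV_d => A 0 (Ordinal td)) Eu; rewrite !mxE /= => ->.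
  apply/eqP; rewrite subr_eq0; apply/eqP.
  rewrite mulr_sumr linear_sum; apply: eq_bigr => i _ /=.
  by rewrite -scalerAr linearZ -exprD /= seq_evalXn !mxE addnC.
exists g => //; split=> // x rx; apply: wG.2.
(* A nonzero remainder of [G] would be a recurrence of order less than [d]. Divisibility then turns
   the roots of [g] into roots of [G], which carry the weight bound. *)
suff : map_poly iota g %| G by move/dvdpP => [q ->]; rewrite rootM rx orbT.
apply/modp_eq0P/eqP; apply: contraT => r0.
have rk : killed (G %% map_poly iota g) a'.
  have kig : killed (map_poly iota g) a'.
    apply: killedP => j; rewrite -(map_polyXn iota) -rmorphM /= evE.
    by rewrite kg rmorph0.
  move=> h; have -> : G %% map_poly iota g = G - G %/ map_poly iota g * map_poly iota g.
    by rewrite [G in G - _](divp_eq G (map_poly iota g)) addrC addKr.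
  by rewrite mulrBr mulrA linearB /= kG kig subr0.
have : (size (G %% map_poly iota g)).-1 \in Q.
  by apply/asboolP; exists (G %% map_poly iota g).
move=> /dmin; have := ltn_modpN0 G mg0; rewrite size_map_poly sg.
by rewrite -size_poly_gt0 in r0; lia.
Qed.

Definition recurrent n (a : nat -> k) :=
  exists2 g : {poly k}, weight_le n (map_poly iota g) & killed g (a : nat -> k^o).

(** The product is treated over [K], where the characteristic polynomials split, and then descended
    to [k]. *)
Lemma recurrentM n m a b : recurrent n a -> recurrent m b ->
  recurrent (n + m) (fun j => a j * b j).
Proof.
move=> [g wg kg] [h wh kh].
have up (u : {poly k}) (c : nat -> k) : killed u (c : nat -> k^o) ->
    killed (map_poly iota u) (fun j => iota (c j) : K^o).
  move=> ku; apply: killedP => j.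
  rewrite -(map_polyXn iota) -rmorphM /=.
  have := congr1 iota (ku 'X^j); rewrite rmorph0 => <-.
  rewrite /seq_eval size_map_poly rmorph_sum; apply: eq_bigr => i _.
  by rewrite coef_map -[X in _ = iota X]/(_ * _) rmorphM.
have [u wu ku] := killed_mul_weight wg wh (up _ _ kg) (up _ _ kh).
apply: killed_descent wu _; apply: killed_ext ku => j.
by rewrite rmorphM.
Qed.

Lemma recurrentW n m a : n <= m -> recurrent n a -> recurrent m a.
Proof. by move=> nm [g wg kg]; exists g => //; apply: weight_leW wg. Qed.

End SequenceProducts.

(** * Constructions on operads *)

Section DegreeCast.
Variables (k : fieldType) (C : complex k).

(** In [dual_obj C j] the [eps] component has degree [j + 1], and the differential fills it with an
    element of degree [i]; these degrees are equal but not convertible. *)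
Definition cx_cast i j (e : i = j) (x : C i) : C j := ecast n (C n) e x.

Lemma cx_cast_id i (e : i = i) x : cx_cast e x = x.
Proof. by rewrite (eq_irrelevance e erefl). Qed.

Lemma cx_cast_linear i j (e : i = j) : linear (cx_cast e).
Proof. by move=> a x y; case: j / e. Qed.

Lemma cx_d_irr i j (e e' : i = j + 1) x : cx_d C e x = cx_d C e' x.
Proof. by rewrite (eq_irrelevance e e'). Qed.

Lemma cx_cast_d i j h (e : i = j) (e' : i = h + 1) (e'' : j = h + 1) x :
  cx_d C e'' (cx_cast e x) = cx_d C e' x.
Proof. by case: j / e e'' => e''; apply: cx_d_irr. Qed.

Lemma cx_d_cast i j j' (e : i = j + 1) (ej : j = j') (e' : i = j' + 1) x :
  cx_cast ej (cx_d C e x) = cx_d C e' x.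
Proof. by case: j' / ej e' => e'; apply: cx_d_irr. Qed.

Lemma cx_cast_d_eq i j (e : i = j + 1) (e' : i + 1 = j + 1 + 1) x y :
  (cx_cast e x = cx_d C e' y) <-> (x = cx_d C (erefl (i + 1)) y).
Proof. by subst i; rewrite cx_cast_id; split=> ->; apply: cx_d_irr. Qed.

End DegreeCast.

Lemma cm_cast (k : fieldType) (C D : complex k) (f : chain_map C D) i j
  (e : i = j) x : f j (cx_cast e x) = cx_cast e (f i x).
Proof. by case: j / e. Qed.

Section OperadLemmas.
Variables (k : fieldType) (P : operad k).
Variables (l m n : nat) (e : (l + m = n)%N) (a : 'I_l.+1).

Lemma op_circ_irr p q r (f f' : p + q = r) (x : P l p) (y : P m q) :
  op_circ P e f a x y = op_circ P e f' a x y.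
Proof. by rewrite (eq_irrelevance f f'). Qed.

Lemma op_circ_castl p p' q r r' (f : p + q = r) (f' : p' + q = r')
  (ep : p = p') (er : r = r') (x : P l p) (y : P m q) :
  op_circ P e f' a (cx_cast ep x) y = cx_cast er (op_circ P e f a x y).
Proof.
by case: p' / ep f' => f'; case: r' / er f' => f'; apply: op_circ_irr.
Qed.

Lemma op_circ_castr p q q' r r' (f : p + q = r) (f' : p + q' = r')
  (eq : q = q') (er : r = r') (x : P l p) (y : P m q) :
  op_circ P e f' a x (cx_cast eq y) = cx_cast er (op_circ P e f a x y).
Proof.
by case: q' / eq f' => f'; case: r' / er f' => f'; apply: op_circ_irr.
Qed.

Variables (p q r : int) (f : p + q = r).

Lemma op_circDl (x x' : P l p) (y : P m q) :
  op_circ P e f a (x + x') y = op_circ P e f a x y + op_circ P e f a x' y.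
Proof. by have /= := op_circ_linl e f a y 1 x x'; rewrite !scale1r. Qed.

Lemma op_circDr (x : P l p) (y y' : P m q) :
  op_circ P e f a x (y + y') = op_circ P e f a x y + op_circ P e f a x y'.
Proof. by have /= := op_circ_linr e f a x 1 y y'; rewrite !scale1r. Qed.

Lemma op_circZl c (x : P l p) (y : P m q) :
  op_circ P e f a (c *: x) y = c *: op_circ P e f a x y.
Proof.
by have /= := op_circ_linl e f a y c x 0; rewrite !addr0 op_circ0l addr0.
Qed.

Lemma op_circZr c (x : P l p) (y : P m q) :
  op_circ P e f a x (c *: y) = c *: op_circ P e f a x y.
Proof.
by have /= := op_circ_linr e f a x c y 0; rewrite !addr0 op_circ0r addr0.
Qed.

Lemma op_circBl (x x' : P l p) (y : P m q) :
  op_circ P e f a (x - x') y = op_circ P e f a x y - op_circ P e f a x' y.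
Proof. by rewrite op_circDl -scaleN1r op_circZl scaleN1r. Qed.

Lemma op_circBr (x : P l p) (y y' : P m q) :
  op_circ P e f a x (y - y') = op_circ P e f a x y - op_circ P e f a x y'.
Proof. by rewrite op_circDr -scaleN1r op_circZr scaleN1r. Qed.

End OperadLemmas.

Section Signs.
Variable k : fieldType.

Lemma signN p : (-1) ^ (p + 1) = - (-1) ^ p :> k.
Proof. by rewrite expfzDr ?oppr_eq0 ?oner_eq0 // expr1z mulrN1. Qed.

Lemma signD p q : (-1) ^ (p + q) = (-1) ^ p * (-1) ^ q :> k.
Proof. by rewrite expfzDr ?oppr_eq0 ?oner_eq0. Qed.

Lemma signM p : (-1) ^ p * (-1) ^ p = 1 :> k.
Proof. by rewrite -expfzMl mulrNN mulr1 exp1rz. Qed.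

End Signs.

(** * Operads tensored with first-order jets of differential forms *)

Section DualNumbers.
Variable k : fieldType.

Definition dual_obj (C : complex k) i : lmodType k :=
  (C i * C i * C (i + 1)%R)%type.

Section Complexes.
Variable C : complex k.

(** The cast term is [d eta = eps]; the minus sign comes from moving [d] past [eps], which has
    degree -1. *)
Definition dual_d i j (e : i = j + 1) (x : dual_obj C i) : dual_obj C j :=
  (cx_d C e x.1.1, cx_d C e x.1.2,
   cx_cast e x.1.2 - cx_d C (congr1 (+%R^~ 1) e) x.2).

Lemma dual_d_is_linear i j e : linear (@dual_d i j e).
Proof.
move=> a x y; congr (_, _, _); rewrite /= ?linearP //.
by rewrite cx_cast_linear [LHS]addrACA scalerN scalerBr.
Qed.

HB.instance Definition _ i j e :=
  GRing.isLinear.Build k (dual_obj C i) (dual_obj C j) *:%R (@dual_d i j e)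
    (@dual_d_is_linear i j e).

Lemma dual_dd i j h (e : i = j + 1) (e' : j = h + 1) x :
  dual_d e' (dual_d e x) = 0.
Proof.
congr (_, _, _); rewrite /= ?cx_dd //.
have e'' : i = h + 1 + 1 by rewrite e e'.
by rewrite linearB /= cx_dd subr0 (cx_cast_d e e'') (cx_d_cast e e' e'') subrr.
Qed.

(* [C] tensored with the commutative dg algebra [k + k eta + k eps] in which
   [eta^2 = eta eps = eps^2 = 0] and [d eta = eps]: the triple [(x, y, z)]
   stands for [x + eta y + eps z]. *)
Definition dual_cx : complex k.
Proof.
exists (dual_obj C) (fun i j e => GRing.Linear.clone _ _ _ _ (@dual_d i j e) _).
exact: dual_dd.
Defined.

End Complexes.

Definition dual_map (C D : complex k) (f : chain_map C D) i (x : dual_obj C i) :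
  dual_obj D i := (f i x.1.1, f i x.1.2, f (i + 1) x.2).

Lemma dual_map_is_linear C D f i : linear (@dual_map C D f i).
Proof. by move=> a x y; congr (_, _, _); rewrite /= linearP. Qed.

HB.instance Definition _ C D f i :=
  GRing.isLinear.Build k (dual_obj C i) (dual_obj D i) *:%R (@dual_map C D f i)
    (@dual_map_is_linear C D f i).

Lemma dual_map_d C D (f : chain_map C D) i j (e : i = j + 1) x :
  dual_map f (dual_d e x) = dual_d e (dual_map f x).
Proof.
congr (_, _, _); rewrite /= ?cm_d //.
by rewrite linearB /= cm_cast cm_d.
Qed.

Definition dual_cm (C D : complex k) (f : chain_map C D) :
  chain_map (dual_cx C) (dual_cx D).
Proof.
exists (fun i => GRing.Linear.clone _ _ _ _ (@dual_map C D f i) _).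
exact: dual_map_d.
Defined.

Variable P : operad k.

Lemma circ_degl (p q r : int) : p + q = r -> p + 1 + q = r + 1.
Proof. by lia. Qed.

Lemma circ_degr (p q r : int) : p + q = r -> p + (q + 1) = r + 1.
Proof. by lia. Qed.

(** The sign is that of moving [eps] past [x]. Products of two of [eta], [eps] vanish, so no other
    cross terms occur. *)
Definition dual_circ l m n (p q r : int) (e : (l + m = n)%N) (f : p + q = r)
    (a : 'I_l.+1) (x : dual_obj (P l) p) (y : dual_obj (P m) q) :
    dual_obj (P n) r :=
  (op_circ P e f a x.1.1 y.1.1,
   op_circ P e f a x.1.2 y.1.1 + op_circ P e f a x.1.1 y.1.2,
   op_circ P e (circ_degl f) a x.2 y.1.1
   + (-1) ^ p *: op_circ P e (circ_degr f) a x.1.1 y.2).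

Lemma dual_act1 l i (x : dual_cx (P l) i) : dual_cm (op_act P 1%g) i x = x.
Proof.
by case: x => [[x y] z]; congr (_, _, _); rewrite /= op_act1.
Qed.

Lemma dual_actM l i (s t : 'S_l.+1) (x : dual_cx (P l) i) :
  dual_cm (op_act P (t * s)%g) i x = dual_cm (op_act P t) i (dual_cm (op_act P s) i x).
Proof.
by case: x => [[x y] z]; congr (_, _, _); rewrite /= op_actM.
Qed.

Lemma dual_linl l m n p q r (e : (l + m = n)%N) (f : p + q = r)
  (a : 'I_l.+1) (y : dual_cx (P m) q) : linear (fun x => dual_circ e f a x y).
Proof.
move=> c x x'; congr (_, _, _); rewrite /=.
- by rewrite op_circDl op_circZl.
- by rewrite !op_circDl !op_circZl scalerDr addrACA.
- rewrite !op_circDl !op_circZl !scalerDr addrACA; congr (_ + (_ + _)).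
  by rewrite !scalerA mulrC.
Qed.

Lemma dual_linr l m n p q r (e : (l + m = n)%N) (f : p + q = r)
  (a : 'I_l.+1) (x : dual_cx (P l) p) : linear (dual_circ e f a x).
Proof.
move=> c y y'; congr (_, _, _); rewrite /=.
- by rewrite op_circDr op_circZr.
- by rewrite !op_circDr !op_circZr scalerDr addrACA.
- rewrite !op_circDr !op_circZr !scalerDr addrACA; congr (_ + (_ + _)).
  by rewrite !scalerA mulrC.
Qed.

Lemma dual_circ_d l m n p q r p' q' r' (e : (l + m = n)%N)
  (f : p + q = r) (f1 : p' + q = r') (f2 : p + q' = r')
  (hp : p = p' + 1) (hq : q = q' + 1) (hr : r = r' + 1)
  (a : 'I_l.+1) (x : dual_cx (P l) p) (y : dual_cx (P m) q) :
  cx_d (dual_cx (P n)) hr (dual_circ e f a x y) =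
    dual_circ e f1 a (cx_d (dual_cx (P l)) hp x) y
    + (-1) ^ p *: dual_circ e f2 a x (cx_d (dual_cx (P m)) hq y).
Proof.
case: x y => [[x1 x2] x3] [[y1 y2] y3].
congr (_, _, _); rewrite /=.
- exact: op_circ_d.
- by rewrite linearD /= !(op_circ_d e f f1 f2 hp hq hr) scalerDr addrACA.
- rewrite linearD linearZ /=.
  rewrite (op_circ_d e (circ_degl f) (circ_degl f1) (circ_degl f2)
    (congr1 (+%R^~ 1) hp) hq).
  rewrite (op_circ_d e (circ_degr f) (circ_degr f1) (circ_degr f2)
    hp (congr1 (+%R^~ 1) hq)).
  have sp : (-1) ^ p = - (-1) ^ p' :> k by rewrite hp signN.
  have sp' : (-1) ^ p' = - (-1) ^ p :> k by rewrite sp opprK.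
  rewrite op_circBl op_circBr (op_circ_castl e a f (circ_degl f1) hp hr).
  rewrite (op_circ_castr e a f (circ_degr f2) hq hr) signN sp'.
  rewrite !scalerDr !scalerN !scaleNr !scalerA signM !scale1r.
  have -> x y : cx_cast hr (x + y) = cx_cast hr x + cx_cast hr y.
    by rewrite -[x]scale1r cx_cast_linear !scale1r.
  by rewrite !opprD !opprK !addrA [LHS](ACl (1*3*5*4*2*6)).
Qed.

Lemma dual_circ_seq l m n lm mn lmn p q r pq qr pqr
  (e1 : (l + m = lm)%N) (e2 : (lm + n = lmn)%N)
  (e3 : (m + n = mn)%N) (e4 : (l + mn = lmn)%N)
  (f1 : p + q = pq) (f2 : pq + r = pqr) (f3 : q + r = qr) (f4 : p + qr = pqr)
  (a : 'I_l.+1) (b : 'I_m.+1) (c : 'I_lm.+1)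
  (x : dual_cx (P l) p) (y : dual_cx (P m) q) (z : dual_cx (P n) r) :
  c = (a + b)%N :> nat ->
  dual_circ e2 f2 c (dual_circ e1 f1 a x y) z =
    dual_circ e4 f4 a x (dual_circ e3 f3 b y z).
Proof.
case: x y z => [[x1 x2] x3] [[y1 y2] y3] [[z1 z2] z3] h.
congr (_, _, _); rewrite /=.
- exact: op_circ_seq.
- rewrite op_circDl op_circDr -addrA; congr (_ + (_ + _)); exact: op_circ_seq.
- rewrite op_circDl op_circZl op_circDr op_circZr scalerDr scalerA -signD f1 -addrA.
  congr (_ + (_ *: _ + _ *: _)); exact: op_circ_seq.
Qed.

Lemma dual_circ_par l m n lm ln lmn p q r pq pr pqr
  (e1 : (l + m = lm)%N) (e2 : (lm + n = lmn)%N)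
  (e3 : (l + n = ln)%N) (e4 : (ln + m = lmn)%N)
  (f1 : p + q = pq) (f2 : pq + r = pqr) (f3 : p + r = pr) (f4 : pr + q = pqr)
  (a b : 'I_l.+1) (a' : 'I_ln.+1) (b' : 'I_lm.+1)
  (x : dual_cx (P l) p) (y : dual_cx (P m) q) (z : dual_cx (P n) r) :
  (a < b)%N -> a' = a :> nat -> b' = (b + m)%N :> nat ->
  dual_circ e2 f2 b' (dual_circ e1 f1 a x y) z =
    (-1) ^ (q * r) *: dual_circ e4 f4 a' (dual_circ e3 f3 b x z) y.
Proof.
case: x y z => [[x1 x2] x3] [[y1 y2] y3] [[z1 z2] z3] h ha hb.
congr (_, _, _); rewrite /=.
- exact: op_circ_par.
- rewrite !op_circDl !scalerDr addrAC; congr (_ + _ + _); exact: op_circ_par.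
- rewrite !op_circDl !op_circZl !scalerDr !scalerA addrAC.
  (* The [eps] components have degree one higher, which changes the sign of the interchange of [y]
     and [z]; moving [eps] across a composite instead of across [x] alone compensates. *)
  have s1 : (-1) ^ (q * r) * (-1) ^ pr = (-1) ^ p * (-1) ^ ((q + 1) * r) :> k.
    by rewrite -f3 mulrDl mul1r !signD; ring.
  have s2 : (-1) ^ (q * r) * (-1) ^ p = (-1) ^ pq * (-1) ^ (q * (r + 1)) :> k.
    by rewrite -f1 mulrDr mulr1 !signD -[LHS]mulr1 -[X in _ * X = _](signM k q); ring.
  rewrite s1 s2 -!scalerA; congr (_ + _ *: _ + _ *: _); exact: op_circ_par.
Qed.

Lemma dual_circ_act l m n p q r (e : (l + m = n)%N) (f : p + q = r)
  (a : 'I_l.+1) (s : 'S_l.+1) (t : 'S_m.+1)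
  (x : dual_cx (P l) p) (y : dual_cx (P m) q) :
  dual_circ e f a (dual_cm (op_act P s) p x) (dual_cm (op_act P t) q y) =
    dual_cm (op_act P (circ_perm e a s t)) r (dual_circ e f (s a) x y).
Proof.
case: x y => [[x1 x2] x3] [[y1 y2] y3].
congr (_, _, _); rewrite /=.
- exact: op_circ_act.
- by rewrite linearD /= !op_circ_act.
- by rewrite linearD linearZ /= !op_circ_act.
Qed.

Definition dual_operad : operad k.
Proof.
apply: (@Operad k (fun l => dual_cx (P l))
  (fun l s => dual_cm (op_act P s)) dual_circ).
- exact: dual_act1.
- exact: dual_actM.
- exact: dual_linl.
- exact: dual_linr.
- exact: dual_circ_d.
- exact: dual_circ_seq.
- exact: dual_circ_par.
- exact: dual_circ_act.
Defined.

End DualNumbers.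

(** * Operads of functions *)

Section FunctionOperad.
Variables (k : fieldType) (S : Type).

Definition fun_map (V W : lmodType k) (f : {linear V -> W}) (x : S -> V) : S -> W :=
  f \o x.

Lemma fun_map_is_linear V W f : linear (@fun_map V W f).
Proof. by move=> a x y; apply/funext => s; rewrite /fun_map /= linearP. Qed.

HB.instance Definition _ (V W : lmodType k) (f : {linear V -> W}) :=
  GRing.isLinear.Build k (S -> V) (S -> W) *:%R (@fun_map V W f)
    (@fun_map_is_linear V W f).

Definition fun_cx (C : complex k) : complex k.
Proof.
exists (fun i => (S -> C i) : lmodType k)
  (fun i j e => GRing.Linear.clone _ _ _ _ (fun_map (cx_d C e)) _).
abstract (by move=> i j h e e' x; apply/funext => s; rewrite /= /fun_map /= cx_dd).
Defined.

Definition fun_cm (C D : complex k) (f : chain_map C D) :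
  chain_map (fun_cx C) (fun_cx D).
Proof.
exists (fun i => GRing.Linear.clone _ _ _ _ (fun_map (f i)) _).
abstract (by move=> i j e x; apply/funext => s; rewrite /= /fun_map /= cm_d).
Defined.

Definition fun_operad (P : operad k) : operad k.
Proof.
apply: (@Operad k (fun l => fun_cx (P l)) (fun l s => fun_cm (op_act P s))
  (fun l m n p q r e f a x y s => op_circ P e f a (x s) (y s))).
- abstract (by move=> l i x; apply/funext => u; apply: op_act1).
- abstract (by move=> l i s t x; apply/funext => u; apply: op_actM).
- abstract (by move=> l m n p q r e f a y c x x'; apply/funext => u; apply: op_circ_linl).
- abstract (by move=> l m n p q r e f a x c y y'; apply/funext => u; apply: op_circ_linr).
- abstract (by move=> *; apply/funext => u; apply: op_circ_d).
- abstract (by move=> *; apply/funext => u; apply: op_circ_seq).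
- abstract (by move=> *; apply/funext => u; apply: op_circ_par).
- abstract (by move=> *; apply/funext => u; apply: op_circ_act).
Defined.

End FunctionOperad.

(** * Suboperads *)

Section Suboperad.
Variables (k : fieldType) (P : operad k).

Record suboperad := Suboperad {
  sub_pred : forall l i, {pred P l i};
  sub_submod : forall l i, submod_closed (@sub_pred l i);
  sub_d : forall l i j (e : i = j + 1) x,
    x \in @sub_pred l i -> cx_d (P l) e x \in @sub_pred l j;
  sub_act : forall l (s : 'S_l.+1) i x,
    x \in @sub_pred l i -> op_act P s i x \in @sub_pred l i;
  sub_circ : forall l m n p q r (e : (l + m = n)%N) (f : p + q = r) a x y,
    x \in @sub_pred l p -> y \in @sub_pred m q ->
    op_circ P e f a x y \in @sub_pred n r
}.

Arguments sub_pred : clear implicits.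

Variable X : suboperad.

HB.instance Definition _ l i :=
  GRing.isSubmodClosed.Build k (P l i) (sub_pred X l i) (@sub_submod X l i).

Record sub_obj l i := SubObj {
  sub_val :> P l i; sub_valP : sub_val \in sub_pred X l i }.
HB.instance Definition _ l i := [isSub for @sub_val l i].
HB.instance Definition _ l i := [Choice of sub_obj l i by <:].
HB.instance Definition _ l i := [SubChoice_isSubLmodule of sub_obj l i by <:].

Definition sub_diff l i j (e : i = j + 1) (x : sub_obj l i) : sub_obj l j :=
  SubObj (sub_d e (sub_valP x)).

Lemma sub_diff_is_linear l i j e : linear (@sub_diff l i j e).
Proof. by move=> a x y; apply: val_inj; rewrite /= linearP. Qed.

HB.instance Definition _ l i j (e : i = j + 1) :=
  GRing.isLinear.Build k (sub_obj l i) (sub_obj l j) *:%R (@sub_diff l i j e)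
    (@sub_diff_is_linear l i j e).

Definition sub_cx (l : nat) : complex k.
Proof.
exists (fun i => sub_obj l i : lmodType k)
  (fun i j e => GRing.Linear.clone _ _ _ _ (@sub_diff l i j e) _).
abstract (by move=> i j h e e' x; apply: val_inj; rewrite /= cx_dd).
Defined.

Definition sub_perm l (s : 'S_l.+1) i (x : sub_obj l i) : sub_obj l i :=
  SubObj (sub_act s (sub_valP x)).

Lemma sub_perm_is_linear l s i : linear (@sub_perm l s i).
Proof. by move=> a x y; apply: val_inj; rewrite /= linearP. Qed.

HB.instance Definition _ l (s : 'S_l.+1) i :=
  GRing.isLinear.Build k (sub_obj l i) (sub_obj l i) *:%R (@sub_perm l s i)
    (@sub_perm_is_linear l s i).

Definition sub_perm_cm l (s : 'S_l.+1) : chain_map (sub_cx l) (sub_cx l).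
Proof.
exists (fun i => GRing.Linear.clone _ _ _ _ (@sub_perm l s i) _).
abstract (by move=> i j e x; apply: val_inj; rewrite /= cm_d).
Defined.

Definition sub_operad : operad k.
Proof.
apply: (@Operad k sub_cx sub_perm_cm
  (fun l m n p q r e f a x y =>
     SubObj (sub_circ e f a (sub_valP x) (sub_valP y)))).
- abstract (by move=> l i x; apply: val_inj; apply: op_act1).
- abstract (by move=> l i s t x; apply: val_inj; apply: op_actM).
- abstract (by move=> l m n p q r e f a y c x x'; apply: val_inj; apply: op_circ_linl).
- abstract (by move=> l m n p q r e f a x c y y'; apply: val_inj; apply: op_circ_linr).
- abstract (by move=> *; apply: val_inj; apply: op_circ_d).
- abstract (by move=> *; apply: val_inj; apply: op_circ_seq).
- abstract (by move=> *; apply: val_inj; apply: op_circ_par).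
- abstract (by move=> *; apply: val_inj; apply: op_circ_act).
Defined.

End Suboperad.

(** * Weight-filtered paths *)

Section TamePaths.
Variables (k : fieldType) (char0 : [pchar k] =i pred0).
Variables (K : closedFieldType) (iota : {rmorphism k -> K}).
Variable w : weight_function K.

Notation recurrent := (recurrent iota w).
Notation weight_le n g := (weight_le w n (map_poly iota g)).

Lemma natr_neq0 n : n.+1%:R != 0 :> k.
Proof. by rewrite ((pcharf0P k).1 char0). Qed.

(** The points [0, ..., N - 1] are distinct in characteristic zero, so their Vandermonde matrix is
    invertible. This identifies polynomials with coefficients in [V] with their value functions. *)
Lemma vandermonde_vanish (V : lmodType k) N (z : nat -> V) :
  (forall t : k, \sum_(m < N) t ^+ m *: z m = 0) -> forall m, (m < N)%N -> z m = 0.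
Proof.
move=> hz m mN; pose A := Vandermonde N (\row_(i < N) i%:R : 'rV[k]_N).
have uA : A \in unitmx.
  rewrite unitmxE det_Vandermonde unitfE; apply/prodf_neq0 => i _.
  apply/prodf_neq0 => j ij; rewrite !mxE -natrB ?(ltnW ij) //.
  by rewrite -(prednK (n := j - i)) ?subn_gt0 // natr_neq0.
have -> : z m = \sum_(j < N) (A *m invmx A) j (Ordinal mN) *: z j.
  rewrite mulmxV // (bigD1 (Ordinal mN)) //= mxE eqxx scale1r big1 ?addr0 // => j jm.
  by rewrite mxE (negPf jm) scale0r.
have E j : (A *m invmx A) j (Ordinal mN) *: z j =
    \sum_(i < N) invmx A i (Ordinal mN) *: ((i%:R : k) ^+ j *: z j).
  by rewrite mxE scaler_suml; apply: eq_bigr => i _; rewrite !mxE scalerA mulrC.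
under eq_bigr do rewrite E.
by rewrite exchange_big big1 // => i _; rewrite -scaler_sumr hz scaler0.
Qed.

Definition path_cx (C : complex k) := fun_cx (nat * k) (dual_cx C).

Definition path_fun (C : complex k) i (a : nat -> k) (b : {poly k}) (x : C i) :
    path_cx C i :=
  fun s => ((a s.1 * b.[s.2]) *: x, (a s.1 * b^`().[s.2]) *: x, 0).

Definition path_form (C : complex k) i (a : nat -> k) (b : {poly k})
    (y : C (i + 1)) : path_cx C i :=
  fun s => (0, 0, (a s.1 * b.[s.2]) *: y).

(* At [s = (j, t)] the components of an element are the values [p_j(t)],
   [p_j'(t)] and [q_j(t)] of a sequence of polynomial differential forms
   [p_j + q_j dt]. *)
Inductive tame (C : complex k) (n i : int) : path_cx C i -> Prop :=
| tame0 : tame n 0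
| tameD u v : tame n u -> tame n v -> tame n (u + v)
| tame_fun a b x : recurrent n a -> tame n (path_fun a b x)
| tame_form a b y : recurrent n a -> tame n (path_form a b y).

Section Complexes.
Variable C : complex k.
Implicit Types (n i : int).

(** Tame elements are the sums of generators, so an additive map need only be checked on the two
    kinds of generators. *)
Lemma tame_additive (D : complex k) n m i j (F : path_cx C i -> path_cx D j) :
  F 0 = 0 -> (forall u v, F (u + v) = F u + F v) ->
  (forall a b x, recurrent n a -> tame m (F (path_fun a b x))) ->
  (forall a b y, recurrent n a -> tame m (F (path_form a b y))) ->
  forall u, tame n u -> tame m (F u).
Proof.
move=> F0 FD Ff Fg u; elim=> {u} [|u v _ Hu _ Hv|a b x|a b y].
- by rewrite F0; apply: tame0.
- by rewrite FD; apply: tameD.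
- exact: Ff.
- exact: Fg.
Qed.

Lemma tameZ n i c (u : path_cx C i) : tame n u -> tame n (c *: u).
Proof.
apply: (tame_additive (F := fun u => c *: u)).
- exact: scaler0.
- exact: scalerDr.
- move=> a b x ra; have -> : c *: path_fun a b x = path_fun a b (c *: x).
    by apply/funext => s; congr (_, _, _); rewrite /= ?scaler0 // !scalerA mulrC.
  exact: tame_fun.
- move=> a b x ra; have -> : c *: path_form a b x = path_form a b (c *: x).
    by apply/funext => s; congr (_, _, _); rewrite /= ?scaler0 // !scalerA mulrC.
  exact: tame_form.
Qed.

Lemma tameB n i (u v : path_cx C i) : tame n u -> tame n v -> tame n (u - v).
Proof. by move=> hu hv; rewrite -scaleN1r; apply/tameD/tameZ. Qed.

Lemma tameW n m i (u : path_cx C i) : n <= m -> tame n u -> tame m u.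
Proof.
move=> nm; apply: (tame_additive (F := id)) => // a b x ra.
  exact/tame_fun/(recurrentW nm).
exact/tame_form/(recurrentW nm).
Qed.

Lemma tame_d n i j (e : i = j + 1) (u : path_cx C i) :
  tame n u -> tame n (cx_d (path_cx C) e u).
Proof.
apply: (tame_additive (F := cx_d (path_cx C) e)).
- exact: linear0.
- exact: linearD.
(* Leibniz rule: [d (b x) = b dx + b' dt x]. *)
- move=> a b x ra; have -> : cx_d (path_cx C) e (path_fun a b x) =
      path_fun a b (cx_d C e x) + path_form a b^`() (cx_cast e x).
    apply/funext => s; congr (_, _, _); rewrite /= ?linearZ /= ?addr0 //.
    rewrite linear0 subr0 add0r -[_ *: x]addr0 cx_cast_linear.
    have -> : cx_cast e (0 : C i) = 0 by case: _ / e.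
    by rewrite addr0.
  by apply: tameD; [apply: tame_fun | apply: tame_form].
- move=> a b x ra; have -> : cx_d (path_cx C) e (path_form a b x) =
      path_form a b (- cx_d C (congr1 (+%R^~ 1) e) x).
    apply/funext => s; congr (_, _, _); rewrite /= ?linear0 //.
    have -> : cx_cast e (0 : C i) = 0 by case: _ / e.
    by rewrite sub0r scalerN linearZ.
  exact: tame_form.
Qed.

Lemma tame_map (D : complex k) (f : chain_map C D) n i (u : path_cx C i) :
  tame n u -> tame n (fun_cm (nat * k) (dual_cm f) i u).
Proof.
apply: (tame_additive (F := fun_cm (nat * k) (dual_cm f) i)).
- exact: linear0.
- exact: linearD.
- move=> a b x ra.
  have -> : fun_cm (nat * k) (dual_cm f) i (path_fun a b x) =
      path_fun a b (f i x).
    by apply/funext => s; congr (_, _, _); rewrite /= ?linearZ ?linear0.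
  exact: tame_fun.
- move=> a b x ra.
  have -> : fun_cm (nat * k) (dual_cm f) i (path_form a b x) =
      path_form a b (f (i + 1) x).
    by apply/funext => s; congr (_, _, _); rewrite /= ?linearZ ?linear0.
  exact: tame_form.
Qed.

Lemma tame_sum n i N (u : nat -> path_cx C i) :
  (forall m, tame n (u m)) -> tame n (\sum_(m < N) u m).
Proof.
move=> hu; elim: N => [|N IH]; first by rewrite big_ord0; apply: tame0.
by rewrite big_ord_recr; apply: tameD.
Qed.

Lemma path_sum i N (u : nat -> path_cx C i) s :
  (\sum_(m < N) u m) s =
    (\sum_(m < N) (u m s).1.1, \sum_(m < N) (u m s).1.2, \sum_(m < N) (u m s).2).
Proof.
elim: N => [|N IH]; first by rewrite !big_ord0.
by rewrite !big_ord_recr /= -[LHS]/((\sum_(m < N) u m) s + u N s) IH.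
Qed.

(** Expansion in the fundamental solutions turns a recurrent sequence of vectors into a finite sum
    of generators. *)
Lemma tame_killed_fun n i (g b : {poly k}) (c : nat -> C i) :
  weight_le n g -> killed g c ->
  tame n ((fun s => (b.[s.2] *: c s.1, b^`().[s.2] *: c s.1, 0)) : path_cx C i).
Proof.
move=> wg kc; have g0 := weight_le_neq0 wg.
set u := (X in tame n X).
have -> : u = \sum_(m < size g) path_fun (fund_sol g m) b (c m).
  apply/funext => -[j t]; rewrite (path_sum _ (fun m => path_fun (fund_sol g m) b (c m))).
  rewrite /u /= (killed_fund_solE g0 kc j) !scaler_sumr.
  congr (_, _, _); last by rewrite big1.
    by apply: eq_bigr => m _; rewrite scalerA mulrC.
  by apply: eq_bigr => m _; rewrite scalerA mulrC.
apply: (tame_sum _ (u := fun m => path_fun (fund_sol g m) b (c m))) => m.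
by apply: tame_fun; exists g => //; apply: killed_fund_sol.
Qed.

Lemma tame_killed_form n i (g : {poly k}) (c : nat -> C (i + 1)) :
  weight_le n g -> killed g c ->
  tame n ((fun s => (0, 0, c s.1)) : path_cx C i).
Proof.
move=> wg kc; have g0 := weight_le_neq0 wg.
set u := (X in tame n X).
have -> : u = \sum_(m < size g) path_form (fund_sol g m) 1 (c m).
  apply/funext => -[j t].
  rewrite (path_sum _ (fun m => path_form (i := i) (fund_sol g m) 1 (c m))).
  rewrite /u /= (killed_fund_solE g0 kc j).
  congr (_, _, _); [by rewrite big1 | by rewrite big1 | apply: eq_bigr => m _].
  by rewrite /= hornerC mulr1.
apply: (tame_sum _ (u := fun m => path_form (i := i) (fund_sol g m) 1 (c m))) => m.
by apply: tame_form; exists g => //; apply: killed_fund_sol.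
Qed.

(** Conversely, at a fixed time the values obey one recurrence, the product of those of the finitely
    many generators. *)
Lemma tame_killed n i (u : path_cx C i) t : tame n u ->
  exists2 g : {poly k}, weight_le n g & killed g (fun j => (u (j, t)).1.1).
Proof.
have w1 : weight_le n (1 : {poly k}).
  by rewrite rmorph1; split=> [|x]; rewrite ?oner_neq0 ?(negPf (root1 _)).
elim=> {u} [|u v _ [g wg kg] _ [h wh kh]|a b x [g wg kg]|a b y _].
- by exists 1 => //; apply: killed0.
- exists (g * h); first by rewrite rmorphM; apply: weight_leM.
  exact: killedD (killed_mulr h kg) (killed_mull g kh).
- exists g => //.
  apply: killed_ext (killed_map (phi := fun c : k^o => (c * b.[t]) *: x) _ kg) => //.
  by move=> c p q; rewrite mulrDl scalerDl -!scalerA.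
- by exists 1 => //; apply: killed0.
Qed.

Lemma antiderivative (b : {poly k}) : exists2 B : {poly k}, B^`() = b & B.[0] = 0.
Proof.
exists (\poly_(m < (size b).+1) (b`_m.-1 / m%:R)); last first.
  by rewrite horner_coef0 coef_poly /= invr0 mulr0.
apply/polyP => m; rewrite coef_deriv coef_poly ltnS; case: ltnP => hm.
  by rewrite -[LHS]mulr_natr mulfVK // natr_neq0.
by rewrite mul0rn nth_default.
Qed.

(** For [u = p + q dt] the element [v] is the integral of [q] from 0 to [t]; integration of
    polynomials requires characteristic zero. *)
Lemma tame_primitive n i (u : path_cx C i) : tame n u ->
  exists2 v : path_cx C (i + 1), tame n v &
    forall s, [/\ (v s).1.2 = (u s).2, (v s).2 = 0 & (v (s.1, 0)).1.1 = 0].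
Proof.
elim=> {u} [|u v _ [u' tu hu] _ [v' tv hv]|a b x ra|a b y ra].
- by exists 0 => //; apply: tame0.
- exists (u' + v'); first exact: tameD.
  move=> s; have [u1 u2 u3] := hu s; have [v1 v2 v3] := hv s.
  by split=> /=; rewrite ?u1 ?v1 ?u2 ?v2 ?u3 ?v3 ?addr0.
- by exists 0 => //; apply: tame0.
- have [B B1 B0] := antiderivative b.
  exists (path_fun a B y); first exact: tame_fun.
  by move=> s; split; rewrite //= ?B1 // B0 mulr0 scale0r.
Qed.

(** For fixed [j] this recovers the polynomial behind the values, and shows that the second
    component is indeed its derivative. *)
Lemma tame_poly n i (u : path_cx C i) j : tame n u ->
  exists N (y : nat -> C i), (forall m, (N <= m)%N -> y m = 0) /\
    forall t, (u (j, t)).1.1 = \sum_(m < N) t ^+ m *: y m /\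
      (u (j, t)).1.2 = \sum_(m < N) t ^+ m *: (y m.+1 *+ m.+1).
Proof.
have widen N N' (y : nat -> C i) t : (N <= N')%N ->
    (forall m, (N <= m)%N -> y m = 0) ->
    \sum_(m < N) t ^+ m *: y m = \sum_(m < N') t ^+ m *: y m.
  move=> NN' hy; rewrite (big_ord_widen _ (fun m => t ^+ m *: y m) NN').
  rewrite big_mkcond; apply: eq_bigr => m _; case: ifPn => //.
  by rewrite -leqNgt => hm; rewrite hy // scaler0.
elim=> {u} [|u v _ [N [y [hy uy]]] _ [N' [y' [hy' vy']]]|a b x _|a b y _].
- exists 0, (fun=> 0); split=> // t; by rewrite !big_ord0.
- exists (maxn N N'), (fun m => y m + y' m); split=> [m|t].
    by rewrite geq_max => /andP[h h']; rewrite hy ?hy' ?addr0.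
  have [u1 u2] := uy t; have [v1 v2] := vy' t.
  split; rewrite /= ?u1 ?u2 ?v1 ?v2.
    rewrite (widen N (maxn N N')) ?leq_maxl //.
    rewrite (widen N' (maxn N N')) ?leq_maxr // -big_split.
    by apply: eq_bigr => m _; rewrite scalerDr.
  rewrite (widen N (maxn N N') (fun m => y m.+1 *+ m.+1)) ?leq_maxl //; last first.
    by move=> m hm; rewrite hy ?mul0rn // leqW.
  rewrite (widen N' (maxn N N') (fun m => y' m.+1 *+ m.+1)) ?leq_maxr //; last first.
    by move=> m hm; rewrite hy' ?mul0rn // leqW.
  by rewrite -big_split; apply: eq_bigr => m _; rewrite mulrnDl scalerDr.
- exists (size b), (fun m => (a j * b`_m) *: x); split=> [m hm|t].
    by rewrite nth_default // mulr0 scale0r.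
  split=> /=.
    rewrite horner_coef mulr_sumr scaler_suml; apply: eq_bigr => m _.
    by rewrite scalerA; congr (_ *: _); ring.
  have sb : (size b^`() <= size b)%N.
    have [->|b0] := eqVneq b 0; first by rewrite deriv0.
    by rewrite ltnW // lt_size_deriv.
  rewrite (horner_coef_wide _ sb) mulr_sumr scaler_suml; apply: eq_bigr => m _.
  by rewrite coef_deriv scalerMnl scalerA; congr (_ *: _); ring.
- exists 0, (fun=> 0); split=> // t; by rewrite !big_ord0.
Qed.

(** Comparing coefficients gives [(m + 1) y_(m+1) = 0], hence [y_(m+1) = 0] in characteristic
    zero. *)
Lemma tame_const n i (u : path_cx C i) : tame n u ->
  (forall s, (u s).1.2 = 0) -> forall j t, (u (j, t)).1.1 = (u (j, 0)).1.1.
Proof.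
move=> tu u0 j t; have [N [y [hy uy]]] := tame_poly j tu.
have y0 m : y m.+1 = 0.
  have [hm|/hy -> //] := ltnP m.+1 N.
  have : y m.+1 *+ m.+1 = 0.
    apply: (vandermonde_vanish (z := fun m => y m.+1 *+ m.+1) _ (ltnW hm)) => t'.
    by rewrite -(uy t').2 u0.
  move=> /eqP; rewrite -scaler_nat scaler_eq0 (negPf (natr_neq0 _)) /=.
  by move/eqP.
rewrite (uy t).1 (uy 0).1; apply: eq_bigr => -[[|m] hm] _ /=.
  by rewrite !expr0.
by rewrite y0 !scaler0.
Qed.

End Complexes.
End TamePaths.

(** * Linearity of homology classes on cycles *)

Section CycleClasses.
Variables (k : fieldType) (C : complex k) (i : int).

Lemma hclass_cycles_linear : linear (fun z : cycles C i => hclass (cycle_val z)).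
Proof. by move=> a x y; rewrite -hclass_linear ?cycle_valP. Qed.

Lemma cycle_val_linear : linear (@cycle_val k C i).
Proof. exact: (linearP (val : cycles C i -> C i)). Qed.

Lemma hclass0 : hclass (0 : C i) = 0.
Proof.
have := hclass_linear (-1) (rpred0 (is_cycle C i)) (rpred0 (is_cycle C i)).
by rewrite scaler0 addr0 scaleN1r addNr.
Qed.

Lemma hclassD : {in is_cycle C i &, forall x y, hclass (x + y) = hclass x + hclass y}.
Proof. by move=> x y cx cy; have := hclass_linear 1 cx cy; rewrite !scale1r. Qed.

Lemma hclassB : {in is_cycle C i &, forall x y, hclass (x - y) = hclass x - hclass y}.
Proof.
by move=> x y cx cy; rewrite hclassD ?rpredN // -scaleN1r hclassZ // scaleN1r.
Qed.

Lemma cycle_cx_d (y : C (i + 1)) : cx_d C (erefl (i + 1)) y \in is_cycle C i.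
Proof. by rewrite unfold_in cx_dd. Qed.

Lemma hclass_eq0 (x : C i) : x \in is_cycle C i ->
  hclass x = 0 <-> exists y, cx_d C (erefl (i + 1)) y = x.
Proof.
move=> cx; split=> [x0|[y <-]]; last exact: hclass_boundary.
have [|z hz] := hclass_eq cx (rpred0 _); first by rewrite x0 hclass0.
by exists z; rewrite -hz subr0.
Qed.

Lemma killed_cycles (g : {poly k}) (z : nat -> cycles C i) :
  killed g (fun j => cycle_val (z j)) -> killed g z.
Proof.
move=> kz h; apply: val_inj; rewrite -(seq_eval_map (phi := val)) ?kz //.
Qed.

End CycleClasses.

(** * Homology of the weight filtration *)

Section WeightFiltration.
Variables (k : fieldType) (char0 : [pchar k] =i pred0).
Variables (K : closedFieldType) (iota : {rmorphism k -> K}).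
Variable w : weight_function K.

Notation weight_le n g := (weight_le w n (map_poly iota g)).
Notation path_cx C := (path_cx C).
Notation tame := (tame iota w).

(** This is all that the computation retains of purity: some polynomial in [f] vanishes, and its
    roots have weight exactly [n]. *)
Definition annihilator_of_weight n (V : lmodType k) (f : V -> V) :=
  exists g : {poly k}, [/\ g != 0,
    forall x, root (map_poly iota g) x -> wt_dom w x /\ w x = n &
    forall h : V, killed g (fun j => iter j f h)].

Lemma coprime_weights n m (g h : {poly k}) : n < m -> weight_le n g ->
  (forall x, root (map_poly iota h) x -> wt_dom w x /\ w x = m) -> coprimep g h.
Proof.
move=> nm [_ wg] wh; rewrite -(coprimep_map iota).
apply/Pdiv.ClosedField.coprimepP => x /wg[_ xn]; apply/negP => /wh[_ xm].
by move: nm; rewrite -xm ltNge xn.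
Qed.

Section Complexes.
Variables (C : complex k) (f : chain_map C C).
Implicit Types (n i : int).

(** For [p + q dt] the condition says that [p] moves through cycles with velocity the boundary of
    [q]. *)
Lemma path_cycleP i (u : path_cx C i) :
  u \in is_cycle (path_cx C) i <-> forall s,
    (u s).1.1 \in is_cycle C i /\ (u s).1.2 = cx_d C (erefl (i + 1)) (u s).2.
Proof.
have e : i = i - 1 + 1 by rewrite subrK.
rewrite (cycle_d e); split=> [/eqP du s|hu].
  have := congr1 (fun v : path_cx C (i - 1) => v s) du => /= -[d1 _ /eqP].
  rewrite subr_eq0 => /eqP/cx_cast_d_eq ->; split=> //.
  by rewrite (cycle_d e) d1.
apply/eqP/funext => s; have [c1 c2] := hu s; rewrite (cycle_d e) in c1.
congr (_, _, _) => /=; first exact/eqP.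
  by rewrite c2 cx_dd.
by apply/eqP; rewrite subr_eq0; apply/eqP/cx_cast_d_eq.
Qed.

Lemma tame_killed_const n i (g : {poly k}) (c : nat -> C i) :
  weight_le n g -> killed g c ->
  tame n ((fun s => (c s.1, 0, 0)) : path_cx C i).
Proof.
move=> wg kc; have := tame_killed_fun 1 wg kc.
congr (tame n _); apply/funext => s.
by rewrite derivC horner0 hornerC scale1r scale0r.
Qed.

(** Poincare lemma on the interval: with [v] the integral of [q], the difference [u - dv] has no
    derivative and no [dt] part, so it is the constant path at the initial value of [u]. *)
Lemma path_homotopy n i (u : path_cx C i) : tame n u ->
  u \in is_cycle (path_cx C) i ->
  exists v : path_cx C (i + 1), [/\ tame n v, forall j, (v (j, 0)).1.1 = 0 &
    forall s, cx_d (path_cx C) (erefl (i + 1)) v s =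
      ((u s).1.1 - (u (s.1, 0)).1.1, (u s).1.2, (u s).2)].
Proof.
move=> tu /path_cycleP cu; have [v tv hv] := tame_primitive char0 tu.
exists v; split=> // [j|s]; first by have [] := hv (j, 0).
have vd s' : cx_d (path_cx C) (erefl (i + 1)) v s' =
    (cx_d C (erefl (i + 1)) (v s').1.1, (u s').1.2, (u s').2).
  have [v2 v3 _] := hv s'; congr (_, _, _) => /=.
    by rewrite v2 (cu s').2.
  by rewrite ?cx_cast_id v2 v3 linear0 subr0.
have r0 s' : ((u - cx_d (path_cx C) (erefl (i + 1)) v) s').1.2 = 0.
  rewrite -[LHS]/((u s').1.2 - (cx_d (path_cx C) (erefl (i + 1)) v s').1.2).
  by rewrite vd subrr.
have := tame_const char0 (tameB tu (tame_d (erefl (i + 1)) tv)) r0 s.1 s.2.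
rewrite -surjective_pairing vd => E.
congr (_, _, _).
have {}E : (u s).1.1 - cx_d C (erefl (i + 1)) (v s).1.1 = (u (s.1, 0)).1.1.
  have : (u s - cx_d (path_cx C) (erefl (i + 1)) v s).1.1 =
    (u (s.1, 0) - cx_d (path_cx C) (erefl (i + 1)) v (s.1, 0)).1.1 := E.
  rewrite !vd /= => ->; have [_ _ /= ->] := hv (s.1, 0).
  by rewrite linear0 subr0.
by rewrite -E opprB [RHS]addrC subrK.
Qed.

(** Such paths alter the endpoint of a cycle path by prescribed boundaries while keeping its
    origin. *)
Lemma connecting_path n i (g : {poly k}) (z : nat -> C i) :
  weight_le n g -> killed g z ->
  (forall j, exists y, cx_d C (erefl (i + 1)) y = z j) ->
  exists v : path_cx C i, [/\ tame n v, v \in is_cycle (path_cx C) i,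
    forall j, (v (j, 0)).1.1 = 0 & forall j, (v (j.+1, 1)).1.1 = z j].
Proof.
move=> wg kz bz; have g0 := weight_le_neq0 wg.
have [y ky yz] := killed_lift (phi := cx_d C (erefl (i + 1))) (linearP _) g0 kz bz.
(* The endpoint condition concerns the index [j + 1], so the bounding chains are moved one place to
   the right. *)
have [m km my] := killed_unshift g0 (weight_le_root0 wg) ky.
have kdm := killed_map (phi := cx_d C (erefl (i + 1))) (linearP _) km.
(* This path is the boundary of [t m_j]. *)
exists ((fun s => (s.2 *: cx_d C (erefl (i + 1)) (m s.1),
  cx_d C (erefl (i + 1)) (m s.1), m s.1)) : path_cx C i).
split=> [||j|j] /=; [| | by rewrite scale0r | by rewrite scale1r my yz].
  have := tameD (tame_killed_fun 'X wg kdm) (tame_killed_form wg km).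
  congr (tame n _); apply/funext => s; congr (_, _, _) => /=.
  - by rewrite hornerX addr0.
  - by rewrite derivX hornerC scale1r addr0.
  - by rewrite add0r.
by apply/path_cycleP => s /=; split=> //; rewrite rpredZ ?cycle_cx_d.
Qed.

Definition weight_part n i (u : path_cx C i) :=
  tame n u /\ forall j, f i (u (j, 0)).1.1 = (u (j.+1, 1)).1.1.

Lemma weight_part_lin n i c (u v : path_cx C i) :
  weight_part n u -> weight_part n v -> weight_part n (c *: u + v).
Proof.
move=> [tu fu] [tv fv]; split; first exact/tameD/tv/tameZ.
by move=> j /=; rewrite linearP fu fv.
Qed.

Lemma weight_part0 n i : weight_part n (0 : path_cx C i).
Proof. by split=> [|j]; [exact: tame0 | rewrite /= linear0]. Qed.

Lemma weight_partW n m i (u : path_cx C i) : n <= m ->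
  weight_part n u -> weight_part m u.
Proof. by move=> nm [tu fu]; split=> //; apply: tameW tu. Qed.

(** Both ends of a cycle path are homologous, so on classes the gluing condition says that [f] takes
    the class at [j] to the class at [j + 1]. *)
Lemma hclass_weight_part n i (u : path_cx C i) : weight_part n u ->
  u \in is_cycle (path_cx C) i -> forall j,
  hclass (u (j, 0)).1.1 = iter j (hmap f i) (hclass (u (0%N, 0)).1.1).
Proof.
move=> [tu fu] cu; elim=> //= j <-; have /path_cycleP cu' := cu.
rewrite hmapE ?(cu' _).1 // fu.
have [v [_ v0 vd]] := path_homotopy tu cu.
have := congr1 (fun x : dual_obj C i => x.1.1) (vd (j.+1, 1)) => /= E.
apply/eqP; rewrite eq_sym -subr_eq0 -hclassB ?(cu' _).1 // -E.
by rewrite hclass_boundary.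
Qed.

Hypothesis pure_f : forall i, annihilator_of_weight i (hmap f i).

(** The orbit of the class is killed both by a polynomial with weights at most [n] and by one with
    weights exactly [i]; these are coprime. *)
Lemma weight_part_vanish n i (u : path_cx C i) : n < i -> weight_part n u ->
  u \in is_cycle (path_cx C) i -> hclass (u (0%N, 0)).1.1 = 0.
Proof.
move=> ni wu cu; have /path_cycleP cu' := cu.
have [chi [chi0 wchi kchi]] := pure_f i.
have [g wg kg] := tame_killed 0 wu.1.
pose z j : cycles C i := Cycle (cu' (j, 0)).1.
have kz : killed g z by apply: killed_cycles.
apply: (killed_coprime (coprime_weights ni wg wchi) (c := fun j =>
  iter j (hmap f i) (hclass (u (0%N, 0)).1.1)) _ (kchi _) 0).
apply: killed_ext (killed_map (@hclass_cycles_linear _ C i) kz) => j /=.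
by rewrite (hclass_weight_part wu cu).
Qed.

(** The orbit of [h] satisfies the recurrence [chi] and lifts to cycles satisfying it too. Then
    [f z_j - z_(j+1)] is a boundary, and a connecting path absorbs it. *)
Lemma weight_part_surj i (h : homology C i) : exists u : path_cx C i,
  [/\ weight_part i u, u \in is_cycle (path_cx C) i &
      hclass (u (0%N, 0)).1.1 = h].
Proof.
have [chi [chi0 wchi kchi]] := pure_f i.
have wchi' : weight_le i chi.
  by split=> [|x /wchi[? ->]]; rewrite ?map_poly_eq0.
have hs j : exists z : cycles C i, hclass (cycle_val z) = iter j (hmap f i) h.
  by have [x cx ->] := hclassP (iter j (hmap f i) h); exists (Cycle cx).
have [z kz zh] := killed_lift (@hclass_cycles_linear _ C i) chi0 (kchi h) hs.
have kz' : killed chi (fun j => cycle_val (z j)).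
  exact: (killed_map (@cycle_val_linear _ C i) kz).
have kfz := killed_map (phi := f i) (linearP _) kz'.
have cz j : cycle_val (z j) \in is_cycle C i := cycle_valP (z j).
have bd j : exists y, cx_d C (erefl (i + 1)) y =
    f i (cycle_val (z j)) - cycle_val (z j.+1).
  apply/hclass_eq0; first by rewrite rpredB ?cm_cycle ?cz.
  by rewrite hclassB ?cm_cycle ?cz // -hmapE ?cz // !zh subrr.
have [v [tv cv v0 v1]] :=
  connecting_path wchi' (killedB kfz (killed_shift kz')) bd.
exists (((fun s => (cycle_val (z s.1), 0, 0)) : path_cx C i) + v).
split; first split.
- by apply: tameD => //; apply: (tame_killed_const wchi' kz').
- by move=> j /=; rewrite v0 addr0 v1 addrC subrK.
- rewrite rpredD //; apply/path_cycleP => s; split=> //=.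
  by rewrite linear0.
- by rewrite /= v0 addr0 zh.
Qed.

(** The bounding element has degree [i + 1] but still weight [i]. The obstruction lies in the
    cokernel of the shift minus [f] on classes of degree [i + 1], and vanishes because the weights
    at most [i] are disjoint from the weight [i + 1]. *)
Lemma weight_part_inj i (u : path_cx C i) : weight_part i u ->
  u \in is_cycle (path_cx C) i -> hclass (u (0%N, 0)).1.1 = 0 ->
  exists2 v : path_cx C (i + 1), weight_part i v &
    cx_d (path_cx C) (erefl (i + 1)) v = u.
Proof.
move=> wu cu u0; have /path_cycleP cu' := cu.
have [g wg kg] := tame_killed 0 wu.1; have g0 := weight_le_neq0 wg.
have bd j : exists y, cx_d C (erefl (i + 1)) y = (u (j, 0)).1.1.
  apply/hclass_eq0; first exact: (cu' _).1.
  rewrite (hclass_weight_part wu cu) u0.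
  by elim: j => //= j ->; rewrite linear0.
have [y ky yu] := killed_lift (phi := cx_d C (erefl (i + 1))) (linearP _) g0 kg bd.
have [I [tI I0 dI]] := path_homotopy wu.1 cu.
(* [v] already bounds [u]; [I] accounts for the motion of the path, [y] for its initial value. Only
   the gluing condition may fail, by the cycles [e j]. *)
pose v := ((fun s => (y s.1, 0, 0)) : path_cx C (i + 1)) + I.
have tv : tame i v by apply: tameD => //; apply: (tame_killed_const wg ky).
have dv : cx_d (path_cx C) (erefl (i + 1)) v = u.
  apply/funext => s; rewrite linearD -[LHS]/(_ s + _ s) dI.
  rewrite [u s]surjective_pairing [(u s).1]surjective_pairing.
  congr (_, _, _) => /=; first by rewrite yu addrC subrK.
    by rewrite linear0 add0r.
  by rewrite ?cx_cast_id linear0 subr0 add0r.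
pose e j := f _ (v (j, 0)).1.1 - (v (j.+1, 1)).1.1.
have dvE s : cx_d C (erefl (i + 1)) (v s).1.1 = (u s).1.1 by rewrite -dv.
have ce j : e j \in is_cycle C (i + 1).
  by rewrite (cycle_d (erefl _)) linearB -cm_d !dvE wu.2 subrr.
have [g1 wg1 kg1] := tame_killed 0 tv; have [g2 wg2 kg2] := tame_killed 1 tv.
have wG : weight_le i (g1 * g2) by rewrite rmorphM; apply: weight_leM.
have kf := killed_map (phi := f (i + 1)) (linearP _) kg1.
have ke : killed (g1 * g2) e.
  exact: killedB (killed_mulr g2 kf) (killed_mull g1 (killed_shift kg2)).
have khe : killed (g1 * g2) (fun j => hclass (e j)).
  have := killed_map (@hclass_cycles_linear _ C (i + 1))
    (killed_cycles (z := fun j => Cycle (ce j)) ke).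
  exact: killed_ext.
have [chi [chi0 wchi kchi]] := pure_f (i + 1).
have i1 : i < i + 1 by rewrite ltrDl.
(* Solving [c_(j+1) - f c_j = [e_j]] makes the defect null-homologous once cycles [z_j] representing
   [c_j] are added to [v]. *)
have [c kc hc] := killed_solve (phi := hmap f (i + 1)) (linearP _)
  (coprime_weights i1 wG wchi) kchi khe.
have hs j : exists z : cycles C (i + 1), hclass (cycle_val z) = c j.
  by have [x cx ->] := hclassP (c j); exists (Cycle cx).
have [z kz zc] := killed_lift (@hclass_cycles_linear _ C (i + 1))
  (weight_le_neq0 wG) kc hs.
have kz' : killed (g1 * g2) (fun j => cycle_val (z j)).
  exact: (killed_map (@cycle_val_linear _ C (i + 1)) kz).
have kfz := killed_map (phi := f (i + 1)) (linearP _) kz'.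
have cz j : cycle_val (z j) \in is_cycle C (i + 1) := cycle_valP (z j).
have cfz j : f _ (cycle_val (z j)) \in is_cycle C (i + 1) by apply/cm_cycle/cz.
have bm j : exists m, cx_d C (erefl (i + 1 + 1)) m =
    e j + (f _ (cycle_val (z j)) - cycle_val (z j.+1)).
  have cB : f _ (cycle_val (z j)) - cycle_val (z j.+1) \in is_cycle C (i + 1).
    exact: rpredB (cfz j) (cz j.+1).
  apply/hclass_eq0; first exact: rpredD (ce j) cB.
  rewrite hclassD // (hclassB (cfz j) (cz j.+1)) -(hmapE f (cz j)) !zc -hc.
  by rewrite addrA subrK subrr.
(* The remaining defect consists of boundaries, and [v'] closes it without changing the initial
   values. *)
have [v' [tv' cv' v'0 v'1]] :=
  connecting_path wG (killedD ke (killedB kfz (killed_shift kz'))) bm.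
exists (v + ((fun s => (cycle_val (z s.1), 0, 0)) : path_cx C (i + 1)) + v').
  split; first exact: tameD (tameD tv (tame_killed_const wG kz')) tv'.
  move=> j; rewrite -[X in f _ X]/((v (j, 0)).1.1 + cycle_val (z j) + (v' (j, 0)).1.1).
  rewrite -[RHS]/((v (j.+1, 1)).1.1 + cycle_val (z j.+1) + (v' (j.+1, 1)).1.1).
  rewrite v'0 addr0 v'1 linearD /e.
  by rewrite [X in _ = _ + X]addrACA -opprD [RHS]addrC subrK.
have dz : ((fun s => (cycle_val (z s.1), 0, 0)) : path_cx C (i + 1))
    \in is_cycle (path_cx C) (i + 1).
  by apply/path_cycleP => s; split=> //=; rewrite linear0.
rewrite (cycle_d (erefl _)) in dz; rewrite (cycle_d (erefl _)) in cv'.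
by rewrite linearD (linearD _ v) /= dv (eqP dz) (eqP cv') !addr0.
Qed.

(** The boundary [du] evaluates to a null class, so it bounds some [r] of weight [j]; then [u - r]
    is the required cycle. *)
Lemma weight_part_split i j (e : i = j + 1) (u : path_cx C i) : weight_part i u ->
  weight_part j (cx_d (path_cx C) e u) ->
  exists2 z, weight_part i z /\ z \in is_cycle (path_cx C) i &
    weight_part j (u - z).
Proof.
move=> wu wdu; subst i.
have cdu : cx_d (path_cx C) (erefl (j + 1)) u \in is_cycle (path_cx C) j.
  exact: cycle_cx_d.
have [|r wr dr] := weight_part_inj wdu cdu.
  exact: hclass_boundary.
exists (u - r); last by have -> : u - (u - r) = r by rewrite opprB [LHS]addrC subrK.
split; last by rewrite (cycle_d (erefl _)) linearB /= dr subrr.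
have -> : u - r = -1 *: r + u by rewrite scaleN1r [RHS]addrC.
apply: weight_part_lin => //.
by apply: weight_partW wr; rewrite lerDl.
Qed.

End Complexes.
End WeightFiltration.

Lemma hmap_bij (k : fieldType) (C D : complex k) (g : chain_map C D) i :
  (forall x, x \in is_cycle C i -> hclass (g i x) = 0 -> hclass x = 0) ->
  (forall y, y \in is_cycle D i ->
    exists2 x, x \in is_cycle C i & hclass (g i x) = hclass y) ->
  bijective (hmap g i).
Proof.
move=> inj surj; have sur (y : homology D i) : exists x, hmap g i x = y.
  have [y' cy ->] := hclassP y; have [x cx xy] := surj y' cy.
  by exists (hclass x); rewrite hmapE.
have [h hK] := choice sur; exists h => // x.
apply/eqP; rewrite -subr_eq0; apply/eqP; set y := _ - x.
have : hmap g i y = 0 by rewrite linearB hK subrr.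
have [y' cy ->] := hclassP y; rewrite hmapE //; exact: inj.
Qed.

(** * Pure endomorphisms and formality *)

Section PureFormal.
Variables (k : fieldType) (char0 : [pchar k] =i pred0).
Variables (K : closedFieldType) (iota : {rmorphism k -> K}).
Variable w : weight_function K.
Variables (P : operad k) (f : operad_hom P P).

Notation tame := (tame iota w).
Notation weight_part := (weight_part iota w).

Definition path_operad := fun_operad (nat * k) (dual_operad P).

(** On generators: functions multiply with coefficients in [C_(w1 + w2)], a function and a form give
    a form, and two forms compose to zero as [eps^2 = 0]. *)
Lemma tame_circ l m n (p q r : int) (e : (l + m = n)%N) (h : p + q = r) a
    (w1 w2 w3 : int) (u : path_operad l p) (v : path_operad m q) :
  w1 + w2 = w3 -> tame w1 (u : path_cx (P l) p) -> tame w2 (v : path_cx (P m) q) ->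
  tame w3 (op_circ path_operad e h a u v : path_cx (P n) r).
Proof.
move=> hw tu tv; move: u tu.
apply: (tame_additive (F := fun u : path_cx (P l) p =>
  (op_circ path_operad e h a u v : path_cx (P n) r))) => [|u u'|b x s rb|b x s rb].
- exact: (op_circ0l (P := path_operad)).
- exact: (op_circDl (P := path_operad)).
- move: v tv; apply: (tame_additive (F := fun v : path_cx (P m) q =>
    (op_circ path_operad e h a (path_fun b x s) v : path_cx (P n) r)))
    => [|v v'|c y t rc|c y t rc].
  + exact: (op_circ0r (P := path_operad)).
  + exact: (op_circDr (P := path_operad)).
  + have -> : op_circ path_operad e h a (path_fun b x s) (path_fun c y t) =
        path_fun (fun j => b j * c j) (x * y) (op_circ P e h a s t) :> path_cx (P n) r.
      apply/funext => o; congr (_, _, _); rewrite /=.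
      * by rewrite op_circZl op_circZr scalerA hornerM; congr (_ *: _); ring.
      * rewrite !op_circZl !op_circZr !scalerA -scalerDl derivM hornerD !hornerM.
        by congr (_ *: _); ring.
      * by rewrite op_circ0l op_circ0r scaler0 addr0.
    by apply: tame_fun; rewrite -hw; apply: recurrentM.
  + have -> : op_circ path_operad e h a (path_fun b x s) (path_form c y t) =
        path_form (fun j => b j * c j) (x * y)
          ((-1) ^ p *: op_circ P e (circ_degr h) a s t) :> path_cx (P n) r.
      apply/funext => o; congr (_, _, _); rewrite /=.
      * by rewrite op_circ0r.
      * by rewrite !op_circ0r addr0.
      * rewrite op_circ0r add0r op_circZl op_circZr !scalerA hornerM.
        by congr (_ *: _); ring.
    by apply: tame_form; rewrite -hw; apply: recurrentM.
- move: v tv; apply: (tame_additive (F := fun v : path_cx (P m) q =>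
    (op_circ path_operad e h a (path_form b x s) v : path_cx (P n) r)))
    => [|v v'|c y t rc|c y t rc].
  + exact: (op_circ0r (P := path_operad)).
  + exact: (op_circDr (P := path_operad)).
  + have -> : op_circ path_operad e h a (path_form b x s) (path_fun c y t) =
        path_form (fun j => b j * c j) (x * y)
          (op_circ P e (circ_degl h) a s t) :> path_cx (P n) r.
      apply/funext => o; congr (_, _, _); rewrite /=.
      * by rewrite op_circ0l.
      * by rewrite !op_circ0l addr0.
      * rewrite op_circ0l scaler0 addr0 op_circZl op_circZr scalerA hornerM.
        by congr (_ *: _); ring.
    by apply: tame_form; rewrite -hw; apply: recurrentM.
  + have -> : op_circ path_operad e h a (path_form b x s) (path_form c y t) = 0.
      apply/funext => o; congr (_, _, _); rewrite /=.
      * by rewrite op_circ0l.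
      * by rewrite !op_circ0l addr0.
      * by rewrite op_circ0l op_circ0r scaler0 addr0.
    exact: tame0.
Qed.

Lemma weight_part_circ l m n (p q r : int) (e : (l + m = n)%N) (h : p + q = r) a
    (w1 w2 w3 : int) (u : path_operad l p) (v : path_operad m q) :
  w1 + w2 = w3 -> weight_part (f l) w1 (u : path_cx (P l) p) ->
  weight_part (f m) w2 (v : path_cx (P m) q) ->
  weight_part (f n) w3 (op_circ path_operad e h a u v : path_cx (P n) r).
Proof.
move=> hw [tu fu] [tv fv]; split; first exact: tame_circ hw tu tv.
by move=> j; rewrite /= hom_circ fu fv.
Qed.

Lemma weight_part_act l (s : 'S_l.+1) n i (u : path_operad l i) :
  weight_part (f l) n (u : path_cx (P l) i) ->
  weight_part (f l) n (op_act path_operad s i u : path_cx (P l) i).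
Proof.
move=> [tu fu]; split=> [|m]; first exact: tame_map.
by rewrite /= hom_act fu.
Qed.

(* Degree zero of Deligne's decalage of the weight filtration. *)
Definition decalage_pred l i : {pred path_operad l i} :=
  fun u => `[< weight_part (f l) i (u : path_cx (P l) i) /\
    forall j (e : i = j + 1),
      weight_part (f l) j (cx_d (path_operad l) e u : path_cx (P l) j) >].

Lemma decalage_submod l i : submod_closed (@decalage_pred l i).
Proof.
split=> [|c u v]; rewrite !unfold_in.
  apply/asboolP; split=> [|j e]; first exact: weight_part0.
  by rewrite linear0; apply: weight_part0.
move=> /asboolP[wu du] /asboolP[wv dv]; apply/asboolP.
split=> [|j e]; first exact: weight_part_lin.
by rewrite linearP; apply: weight_part_lin.
Qed.

Lemma decalage_d l i j (e : i = j + 1) u : u \in @decalage_pred l i ->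
  cx_d (path_operad l) e u \in @decalage_pred l j.
Proof.
move=> /asboolP[wu du]; apply/asboolP; split=> [|m e']; first exact: du.
by rewrite cx_dd; apply: weight_part0.
Qed.

Lemma decalage_act l (s : 'S_l.+1) i u : u \in @decalage_pred l i ->
  op_act path_operad s i u \in @decalage_pred l i.
Proof.
move=> /asboolP[wu du]; apply/asboolP.
split=> [|j e]; first exact: weight_part_act.
by rewrite -cm_d; apply: weight_part_act.
Qed.

Lemma decalage_circ l m n p q r (e : (l + m = n)%N) (h : p + q = r) a u v :
  u \in @decalage_pred l p -> v \in @decalage_pred m q ->
  op_circ path_operad e h a u v \in @decalage_pred n r.
Proof.
move=> /asboolP[wu du] /asboolP[wv dv]; apply/asboolP.
split=> [|r' er]; first exact: weight_part_circ h wu wv.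
have h1 : p - 1 + q = r' by lia.
have h2 : p + (q - 1) = r' by lia.
rewrite (op_circ_d e h h1 h2 (esym (subrK 1 p)) (esym (subrK 1 q))) addrC.
apply: weight_part_lin; first exact: weight_part_circ h2 wu (dv _ _).
exact: weight_part_circ h1 (du _ _) wv.
Qed.

Definition decalage : suboperad path_operad :=
  Suboperad decalage_submod decalage_d decalage_act decalage_circ.

Definition decalage_operad := sub_operad decalage.

Definition decalage_ev l i (u : decalage_operad l i) : P l i :=
  (sub_val u (0%N, 0)).1.1.

Lemma decalage_ev_is_linear l i : linear (@decalage_ev l i).
Proof. by []. Qed.

HB.instance Definition _ l i :=
  GRing.isLinear.Build k (decalage_operad l i) (P l i) *:%R (@decalage_ev l i)
    (@decalage_ev_is_linear l i).

Definition decalage_ev_cm l : chain_map (decalage_operad l) (P l).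
Proof.
by exists (fun i => GRing.Linear.clone _ _ _ _ (@decalage_ev l i) _).
Defined.

Definition decalage_ev_hom : operad_hom decalage_operad P.
Proof. by exists decalage_ev_cm. Defined.

Lemma decalageP l i (u : decalage_operad l i) :
  weight_part (f l) i (sub_val u : path_cx (P l) i) /\
  forall j (e : i = j + 1),
    weight_part (f l) j (cx_d (path_operad l) e (sub_val u) : path_cx (P l) j).
Proof. exact/asboolP/(sub_valP u). Qed.

Lemma decalage_cycle l i (u : decalage_operad l i) :
  u \in is_cycle (decalage_operad l) i ->
  (sub_val u : path_cx (P l) i) \in is_cycle (path_cx (P l)) i.
Proof.
by rewrite !unfold_in => /eqP/(congr1 (@sub_val _ _ _ l _))/= ->.
Qed.

(** * The two weak equivalences out of the decalage *)

Hypothesis pure_f : forall l i, annihilator_of_weight iota w i (hmap (f l) i).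

Definition leading_cycle l i (u z : path_cx (P l) i) :=
  [/\ weight_part (f l) i z, z \in is_cycle (path_cx (P l)) i &
      weight_part (f l) (i - 1) (u - z)].

Lemma leading_cycle_exists l i (u : decalage_operad l i) :
  exists z, leading_cycle (sub_val u : path_cx (P l) i) z.
Proof.
have [wu du] := decalageP u.
have [z [wz cz] wuz] := weight_part_split char0 (@pure_f l) wu (du _ (esym (subrK 1 i))).
by exists z.
Qed.

(** Two choices differ by a cycle of degree [i] and weight [i - 1], whose class vanishes. Hence the
    choice made in [decalage_class] is immaterial. *)
Lemma leading_cycle_class l i (u z z' : path_cx (P l) i) :
  leading_cycle u z -> leading_cycle u z' ->
  hclass (z (0%N, 0)).1.1 = hclass (z' (0%N, 0)).1.1.
Proof.
move=> [wz cz wuz] [wz' cz' wuz'].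
have /path_cycleP pz := cz; have /path_cycleP pz' := cz'.
apply/eqP; rewrite -subr_eq0 -hclassB ?(pz _).1 ?(pz' _).1 //; apply/eqP.
apply: (weight_part_vanish char0 (@pure_f l) (n := i - 1) (u := z - z')).
- by rewrite ltrBlDr ltrDl.
- have -> : z - z' = (-1) *: (u - z) + (u - z').
    by rewrite scaleN1r opprB addrA subrK.
  exact: weight_part_lin.
- exact: rpredB.
Qed.

Definition decalage_class l i (u : decalage_operad l i) : homology (P l) i :=
  hclass (sval (cid (leading_cycle_exists u)) (0%N, 0)).1.1.

Lemma decalage_classE l i (u : decalage_operad l i) z :
  leading_cycle (sub_val u : path_cx (P l) i) z ->
  decalage_class u = hclass (z (0%N, 0)).1.1.
Proof.
rewrite /decalage_class; case: cid => z' hz' hz.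
exact: leading_cycle_class hz' hz.
Qed.

Lemma leading_cycle_self l i (u : decalage_operad l i) :
  u \in is_cycle (decalage_operad l) i ->
  leading_cycle (sub_val u : path_cx (P l) i) (sub_val u).
Proof.
move=> cu; split; [exact: (decalageP u).1 | exact: decalage_cycle |].
by rewrite subrr; apply: weight_part0.
Qed.

Lemma decalage_class_is_linear l i : linear (@decalage_class l i).
Proof.
move=> c u v; have [z hz] := leading_cycle_exists u.
have [y hy] := leading_cycle_exists v.
rewrite (decalage_classE hz) (decalage_classE hy).
case: hz hy => wz cz wuz [wy cy wvy].
rewrite (@decalage_classE _ _ _ (c *: z + y)); last first.
  split; [exact: weight_part_lin | by rewrite rpredD ?rpredZ |].
  have -> : sub_val (c *: u + v) - (c *: z + y) =
      c *: (sub_val u - z) + (sub_val v - y) :> path_cx (P l) i.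
    by rewrite scalerBr opprD addrACA.
  exact: weight_part_lin.
have /path_cycleP pz := cz; have /path_cycleP py := cy.
by rewrite -hclass_linear ?(pz _).1 ?(py _).1.
Qed.

HB.instance Definition _ l i :=
  GRing.isLinear.Build k (decalage_operad l i) (homology (P l) i) *:%R
    (@decalage_class l i) (@decalage_class_is_linear l i).

Definition decalage_class_cm l : chain_map (decalage_operad l) (homology_operad P l).
Proof.
exists (fun i => GRing.Linear.clone _ _ _ _ (@decalage_class l i) _).
move=> i j e u; rewrite -[RHS]/(0 : homology (P l) j).
have cdu : cx_d (decalage_operad l) e u \in is_cycle (decalage_operad l) j.
  by rewrite unfold_in cx_dd.
rewrite -[LHS]/(decalage_class (cx_d (decalage_operad l) e u)).
by rewrite (decalage_classE (leading_cycle_self cdu)) /= hclass_boundary.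
Defined.

Lemma leading_cycle_act l (s : 'S_l.+1) i (u z : path_operad l i) :
  leading_cycle (u : path_cx (P l) i) z ->
  leading_cycle (op_act path_operad s i u : path_cx (P l) i)
    (op_act path_operad s i z).
Proof.
move=> [wz cz wuz]; split; first exact: weight_part_act.
  exact: (cm_cycle (op_act path_operad s)).
by rewrite -linearB; apply: weight_part_act.
Qed.

Lemma leading_cycle_circ l m n (p q r : int) (e : (l + m = n)%N) (h : p + q = r) a
    (u y : path_operad l p) (v z : path_operad m q) :
  weight_part (f m) q (v : path_cx (P m) q) ->
  leading_cycle (u : path_cx (P l) p) y -> leading_cycle (v : path_cx (P m) q) z ->
  leading_cycle (op_circ path_operad e h a u v : path_cx (P n) r)
    (op_circ path_operad e h a y z).
Proof.
move=> wv [wy cy wuy] [wz cz wvz]; split; first exact: weight_part_circ h wy wz.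
  exact: (op_circ_cycle (P := path_operad)).
(* The usual splitting of a difference of products: each term has one factor of lowered weight. *)
have -> : (op_circ path_operad e h a u v - op_circ path_operad e h a y z) =
    1 *: op_circ path_operad e h a (u - y) v + op_circ path_operad e h a y (v - z).
  rewrite scale1r (op_circBl (P := path_operad)) (op_circBr (P := path_operad)).
  by rewrite addrA subrK.
apply: weight_part_lin.
  by apply: weight_part_circ wuy wv; lia.
by apply: weight_part_circ wy wvz; lia.
Qed.

Definition decalage_class_hom : operad_hom decalage_operad (homology_operad P).
Proof.
exists decalage_class_cm.
- move=> l i s u; have [z hz] := leading_cycle_exists u.
  rewrite -[LHS]/(decalage_class (op_act decalage_operad s i u)).
  rewrite -[X in op_act (homology_operad P) _ _ X]/(decalage_class u) (decalage_classE hz).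
  rewrite (@decalage_classE _ _ (op_act decalage_operad s i u) _ (leading_cycle_act s hz)).
  by case: hz => _ /path_cycleP cz _; rewrite homology_actE ?(cz _).1.
- move=> l m n p q r e h a u v.
  have [y hy] := leading_cycle_exists u; have [z hz] := leading_cycle_exists v.
  rewrite -[LHS]/(decalage_class (op_circ decalage_operad e h a u v)).
  rewrite -[X in op_circ (homology_operad P) _ _ _ X]/(decalage_class u) (decalage_classE hy).
  rewrite -[X in op_circ (homology_operad P) _ _ _ _ X]/(decalage_class v) (decalage_classE hz).
  rewrite (@decalage_classE _ _ (op_circ decalage_operad e h a u v) _
    (leading_cycle_circ e h a (decalageP v).1 hy hz)).
  case: hy hz => _ /path_cycleP cy _ [_ /path_cycleP cz _].
  by rewrite homology_circE ?(cy _).1 ?(cz _).1.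
Defined.

Lemma weight_part_decalage l i (u : path_cx (P l) i) : weight_part (f l) i u ->
  u \in is_cycle (path_cx (P l)) i -> u \in @decalage_pred l i.
Proof.
move=> wu cu; apply/asboolP; split=> // j e.
by move: cu; rewrite (cycle_d e) => /eqP ->; apply: weight_part0.
Qed.

(** The bounding [v] has degree [i + 1] and weight [i], as does [dv = u], so [v] belongs to the
    decalage. This serves for the injectivity of both weak equivalences. *)
Lemma decalage_null l i (u : decalage_operad l i) :
  u \in is_cycle (decalage_operad l) i ->
  hclass (sub_val u (0%N, 0)).1.1 = 0 -> hclass u = 0.
Proof.
move=> cu u0.
have [v wv dv] := weight_part_inj char0 (@pure_f l) (decalageP u).1
  (decalage_cycle cu) u0.
have Dv : v \in @decalage_pred l (i + 1).
  apply/asboolP; split=> [|j e]; first by apply: weight_partW wv; rewrite lerDl.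
  have ij := addIr _ e; subst j; rewrite (eq_irrelevance e erefl).
  by have := (decalageP u).1; rewrite -dv.
have -> : u = cx_d (decalage_operad l) (erefl (i + 1)) (SubObj (X := decalage) Dv).
  by apply: val_inj; rewrite /= dv.
exact: hclass_boundary.
Qed.

Lemma decalage_lift l i (h : homology (P l) i) :
  exists2 u : decalage_operad l i, u \in is_cycle (decalage_operad l) i &
    hclass (sub_val u (0%N, 0)).1.1 = h.
Proof.
have [u [wu cu uh]] := weight_part_surj (@pure_f l) h.
by exists (SubObj (X := decalage) (weight_part_decalage wu cu)).
Qed.

Lemma decalage_ev_weq : weak_equivalence decalage_ev_hom.
Proof.
move=> l i; apply: hmap_bij => [u cu|y _]; first exact: decalage_null.
by have [u cu uy] := decalage_lift (hclass y); exists u.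
Qed.

Lemma decalage_class_weq : weak_equivalence decalage_class_hom.
Proof.
have cH l i (x : homology_operad P l i) : x \in is_cycle (homology_operad P l) i.
  by rewrite unfold_in.
move=> l i; apply: hmap_bij => [u cu u0|y cy].
  (* The target has zero differential, so a null class there is already the zero element. *)
  have [|y hy] := (hclass_eq0 (cH l i (decalage_class u))).1; first exact: u0.
  apply: decalage_null => //.
  by rewrite -(decalage_classE (leading_cycle_self cu)) -hy.
have [u cu uy] := decalage_lift y; exists u => //; congr (hclass _).
by rewrite -uy -(decalage_classE (leading_cycle_self cu)).
Qed.

Lemma pure_formal : inhabited (zigzag P (homology_operad P)).
Proof.
by constructor; apply: ZigBwd decalage_ev_weq (ZigFwd decalage_class_weq (ZigNil _)).
Qed.

End PureFormal.

(** * The equivalences *)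

Section Zigzags.
Variable k : fieldType.

Fixpoint zigzag_cat (P Q R : operad k) (z : zigzag P Q) : zigzag Q R -> zigzag P R :=
  match z with
  | ZigNil _ => id
  | ZigFwd _ _ _ f wf z' => fun y => ZigFwd wf (zigzag_cat z' y)
  | ZigBwd _ _ _ f wf z' => fun y => ZigBwd wf (zigzag_cat z' y)
  end.

Fixpoint zigzag_rev (P Q : operad k) (z : zigzag P Q) : zigzag Q P :=
  match z with
  | ZigNil P => ZigNil P
  | ZigFwd P _ _ f wf z' => zigzag_cat (zigzag_rev z') (ZigBwd wf (ZigNil P))
  | ZigBwd P _ _ f wf z' => zigzag_cat (zigzag_rev z') (ZigFwd wf (ZigNil P))
  end.

Lemma hom_invK (P Q : operad k) (f : operad_hom P Q)
    (bf : forall l i, bijective (f l i)) l i :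
  cancel (hom_inv bf l i) (f l i).
Proof. exact: cm_inv_funK. Qed.

Lemma homK_inv (P Q : operad k) (f : operad_hom P Q)
    (bf : forall l i, bijective (f l i)) l i :
  cancel (f l i) (hom_inv bf l i).
Proof. by move=> x; apply: (bij_inj (bf l i)); rewrite hom_invK. Qed.

Lemma hom_inv_bij (P Q : operad k) (f : operad_hom P Q)
    (bf : forall l i, bijective (f l i)) l i :
  bijective (hom_inv bf l i).
Proof. exact: Bijective (@hom_invK _ _ _ bf l i) (@homK_inv _ _ _ bf l i). Qed.

Lemma bij_weak_equivalence (P Q : operad k) (f : operad_hom P Q) :
  (forall l i, bijective (f l i)) -> weak_equivalence f.
Proof.
move=> bf l i; apply: hmap_bij => [x cx|y cy].
  move=> /(hclass_eq0 (cm_cycle (f l) cx))[y hy]; apply/hclass_eq0 => //.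
  exists (hom_inv bf l (i + 1) y).
  by rewrite -cm_d hy homK_inv.
exists (hom_inv bf l i y); last by rewrite hom_invK.
exact: cm_cycle.
Qed.

Lemma bij_automorphism (P : operad k) (f : operad_hom P P) :
  (forall l i, bijective (f l i)) -> automorphism f.
Proof.
move=> bf; exists (hom_inv bf); split=> l i x.
  exact: homK_inv.
exact: hom_invK.
Qed.

Lemma automorphism_bij (P : operad k) (f : operad_hom P P) :
  automorphism f -> forall l i, bijective (f l i).
Proof. by move=> [g [gf fg]] l i; exists (g l i); [apply: gf | apply: fg]. Qed.

(** * An operad with zero differential is its own homology *)

Section ZeroDifferential.
Variable P : operad k.
Let HP := homology_operad P.

Lemma homology_is_cycle l i (x : HP l i) : x \in is_cycle (HP l) i.
Proof. by rewrite unfold_in. Qed.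

Lemma homology_hclass_is_linear l i :
  linear (fun x : HP l i => hclass x : homology (HP l) i).
Proof. by move=> c x y; rewrite hclass_linear // homology_is_cycle. Qed.

Definition homology_hclass l i (x : HP l i) : homology (HP l) i := hclass x.

HB.instance Definition _ l i :=
  GRing.isLinear.Build k (HP l i) (homology (HP l) i) *:%R
    (@homology_hclass l i) (@homology_hclass_is_linear l i).

Definition homology_hclass_cm l : chain_map (HP l) (homology_operad HP l).
Proof.
exists (fun i => GRing.Linear.clone _ _ _ _ (@homology_hclass l i) _).
by move=> i j e x; apply: hclass0.
Defined.

Definition homology_hclass_hom : operad_hom HP (homology_operad HP).
Proof.
exists homology_hclass_cm.
- by move=> l i s x; apply/esym/homology_actE/homology_is_cycle.
- by move=> l m n p q r e f a x y; apply/esym/homology_circE; apply: homology_is_cycle.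
Defined.

Lemma homology_hclass_bij l i : bijective (homology_hclass_hom l i).
Proof.
exists (fun h : homology (HP l) i => hrepr h) => [x|h]; last exact: hreprK.
have cr := hrepr_cycle (hclass x).
have [|y hy] := hclass_eq cr (homology_is_cycle x); first exact: hreprK.
by apply/eqP; rewrite -subr_eq0; apply/eqP.
Qed.

End ZeroDifferential.
End Zigzags.

(** * Grading automorphisms, weight functions and purity *)

Section GradingAutomorphism.
Variables (k : fieldType) (P : operad k).

Lemma grading_aut_automorphism (alpha : k) (alpha0 : alpha != 0) :
  automorphism (grading_aut P alpha0).
Proof.
apply: bij_automorphism => l i; have ai0 : alpha ^ i != 0 by rewrite expfz_neq0.
exists (fun x => (alpha ^ i)^-1 *: x) => x; rewrite -[grading_aut _ _ _ _ _]/(_ *: _).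
  by rewrite scalerA mulVf // scale1r.
by rewrite scalerA mulfV // scale1r.
Qed.

End GradingAutomorphism.

(** The powers of [a] form an infinite cyclic group because [a] is not a root of unity, and the
    exponent is a morphism on it. *)
Lemma powers_weight (K : fieldType) (a : K) : a != 0 ->
  (forall n, (0 < n)%N -> a ^+ n != 1) ->
  exists w : weight_function K, forall n : int, wt_dom w (a ^ n) /\ w (a ^ n) = n.
Proof.
move=> a0 a1.
have inj (n m : int) : a ^ n = a ^ m -> n = m.
  wlog mn : n m / m <= n => [H E|E].
    by case: (lerP m n) => h; [exact: H | apply/esym/H => //; exact: ltW].
  have : a ^ (n - m) = 1 by rewrite expfzDr // E -expfzDr // subrr.
  have nm0 : 0 <= n - m by rewrite subr_ge0.
  rewrite -(gez0_abs nm0) -exprnP; case E' : `|n - m|%N => [|d].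
    by move/eqP: E'; rewrite absz_eq0 subr_eq0 => /eqP.
  by move=> /eqP; rewrite (negPf (a1 d.+1 _)).
pose D x := exists n : int, x = a ^ n.
pose W x : int := if pselect (D x) is left h then sval (cid h) else 0.
have WE n : W (a ^ n) = n.
  rewrite /W; case: pselect => [h|[]]; last by exists n.
  by case: cid => m /= /inj.
have Dn0 x : D x -> x != 0 by move=> [n ->]; rewrite expfz_neq0.
have D1 : D 1 by exists 0.
have DM x y : D x -> D y -> D (x * y).
  by move=> [n ->] [m ->]; exists (n + m); rewrite expfzDr.
have DV x : D x -> D x^-1 by move=> [n ->]; exists (- n); rewrite invr_expz.
have WM x y : D x -> D y -> W (x * y) = W x + W y.
  by move=> [n ->] [m ->]; rewrite -expfzDr // !WE.
exists (WeightFunction Dn0 D1 DM DV WM) => n; split=> //=.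
by exists n.
Qed.

Lemma findim_basis (k : fieldType) (V : lmodType k) : findim V ->
  exists n (b : 'I_n -> V), is_basis b.
Proof.
pose Q n := `[< exists b : 'I_n -> V,
  forall v, exists c : 'rV[k]_n, v = \sum_j c 0 j *: b j >].
move=> [n0 hn0]; have exQ : exists n, Q n by exists n0; apply/asboolP.
case: (ex_minnP exQ) => n /asboolP[b hb] nmin; exists n, b => v.
have [c hc] := hb v; exists c; split=> // c' hc'.
apply: contrapT => /eqP; rewrite eq_sym => cc'.
have [j0 cj] : exists j, c' 0 j != c 0 j.
  by apply/existsP; apply: contraNT cc' => /existsPn h; apply/eqP/rowP => j; apply/eqP/negbNE/h.
(* With two expansions of [v], the vector [b j0] depends on the others, against the minimality of
   the spanning family. *)
case: n => [|n] in b hb nmin c c' hc hc' cc' j0 cj *; first by case: j0 cj.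
suff /nmin : Q n by rewrite ltnn.
apply/asboolP.
pose d := c - c'; have d0 : d 0 j0 != 0 by rewrite !mxE subr_eq0 eq_sym.
have E : \sum_j d 0 j *: b j = 0.
  under eq_bigr do rewrite !mxE scalerBl.
  by rewrite sumrB -hc -hc' subrr.
have Eb : b j0 = \sum_(i < n) (- (d 0 j0)^-1 * d 0 (lift j0 i)) *: b (lift j0 i).
  move: E; rewrite (bigD1_ord j0) //= => /eqP; rewrite addr_eq0 => /eqP E.
  under eq_bigr do rewrite -scalerA.
  by rewrite -scaler_sumr scaleNr -scalerN -E scalerA mulVf // scale1r.
exists (b \o lift j0) => u; have [e ->] := hb u.
exists (\row_i (e 0 (lift j0 i) - e 0 j0 * (d 0 j0)^-1 * d 0 (lift j0 i))).
rewrite (bigD1_ord j0) //= [in LHS]Eb scaler_sumr -big_split.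
apply: eq_bigr => i _ /=; rewrite !mxE scalerA -scalerDl; congr (_ *: _); ring.
Qed.

Section Pure.
Variables (k : fieldType) (K : fieldType) (iota : {rmorphism k -> K}).
Variable w : weight_function K.

Lemma pure_scale n (V : lmodType k) (f : {linear V -> V}) a : findim V ->
  (forall v, f v = a *: v) -> wt_dom w (iota a) -> w (iota a) = n ->
  pure iota w n f.
Proof.
move=> /findim_basis[m [b hb]] fa da wa; exists m, b, a%:M; split=> // [j|x].
  rewrite fa (bigD1 j) //= mxE eqxx big1 ?addr0 // => i ij.
  by rewrite mxE (negPf ij) scale0r.
rewrite map_char_poly map_scalar_mx char_poly_trig; last first.
  by apply/is_trig_mxP => i j ij; rewrite mxE -val_eqE ltn_eqF.
rewrite rootE horner_prod => /prodf_eq0[i _].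
by rewrite mxE eqxx hornerXsubC subr_eq0 => /eqP ->.
Qed.

End Pure.

(** Cayley-Hamilton: the characteristic polynomial annihilates [f], and its roots are the
    eigenvalues. *)
Lemma pure_annihilator (k : fieldType) (K : closedFieldType)
  (iota : {rmorphism k -> K}) (w : weight_function K) n (V : lmodType k)
  (f : {linear V -> V}) : pure iota w n f -> annihilator_of_weight iota w n f.
Proof.
move=> [m [b [A [hb fb hA]]]]; exists (char_poly A); split=> // [|h].
  exact/monic_neq0/char_poly_monic.
have [c [hc _]] := hb h.
(* Square matrices form a ring with [1 != 0] only in positive size, so the zero space is treated
   apart. *)
case: m => [|m] in b A hb fb hA c hc *.
  apply: killed_ext (killed0 _ _) => j; rewrite hc big_ord0.
  by elim: j => //= j <-; rewrite linear0.
pose T (x : 'cV[k]_m.+1) := \sum_i x i 0 *: b i.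
have TL : linear T.
  move=> a x y; rewrite scaler_sumr -big_split; apply: eq_bigr => i _.
  by rewrite !mxE scalerDl scalerA.
have fT x : f (T x) = T (A *m x).
  rewrite linear_sum /T; under eq_bigr do rewrite linearZ /= fb scaler_sumr.
  rewrite exchange_big; apply: eq_bigr => i _; rewrite mxE scaler_suml.
  by apply: eq_bigr => j _; rewrite scalerA mulrC.
have hE j : T (A ^+ j *m c^T) = iter j f h.
  elim: j => [|j IH] /=; last by rewrite -IH fT mulmxA exprS.
  by rewrite mul1mx hc; apply: eq_bigr => i _; rewrite mxE.
move=> u; rewrite -(seq_eval_ext (phi := fun u => T (horner_mx A u *m c^T))).
- rewrite rmorphM /= Cayley_Hamilton mulr0 mul0mx.
  by have := TL (-1) 0 0; rewrite scaler0 addr0 scaleN1r addNr.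
- by move=> a x y; rewrite linearP mulmxDl -scalemxAl TL.
- by move=> j; rewrite rmorphXn /= horner_mx_X hE.
Qed.

(** * Formality, lifting of automorphisms, and purity *)

Section Implications.
Variables (k : fieldType) (P : operad k).

(** Formality is obtained for the model [P']; it passes to [P] because the isomorphism of homology
    operads induced by [z] is itself a weak equivalence. *)
Lemma pure_endomorphism_formal (char0 : [pchar k] =i pred0) (K : closedFieldType)
    (iota : {rmorphism k -> K}) (w : weight_function K) (P' : operad k)
    (z : zigzag P' P) (f : operad_hom P' P') :
  pure_endomorphism iota w f -> formal P.
Proof.
move=> pf.
have [y] := pure_formal char0 (fun l i => pure_annihilator (pf l i)).
constructor; apply: zigzag_cat (zigzag_rev z) (zigzag_cat y _).
exact: ZigFwd (bij_weak_equivalence (zigzag_hom_bij z)) (ZigNil _).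
Qed.

Lemma H_along_comp (P' : operad k) (z : zigzag P' P) (f : operad_hom P' P') l i x :
  H_along z f l i (zigzag_hom z l i x) = zigzag_hom z l i (homology_hom f l i x).
Proof.
rewrite -[LHS]/(zigzag_hom z l i
  (homology_hom f l i (hom_inv (zigzag_hom_bij z) l i (zigzag_hom z l i x)))).
by rewrite homK_inv.
Qed.

(** The model is the homology operad itself. The given zigzag may identify its homology with that of
    [P] differently from [kappa], so [g] is conjugated by both identifications. *)
Lemma formal_lift_automorphisms : formal P ->
  exists (P' : operad k) (z : zigzag P' P),
    forall g : operad_hom (homology_operad P) (homology_operad P),
      automorphism g ->
      exists f : operad_hom P' P', automorphism f /\ H_along z f =h g.
Proof.
move=> [y]; pose z := zigzag_rev y; exists (homology_operad P), z => g ag.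
have bz := zigzag_hom_bij z; have bk := @homology_hclass_bij k P.
pose Z := zigzag_hom z; pose kappa := homology_hclass_hom P.
have bg := automorphism_bij ag.
pose g' := hom_comp (hom_inv bz) (hom_comp g Z).
pose f := hom_comp (hom_inv bk) (hom_comp g' kappa).
have bg' l i : bijective (g' l i).
  by apply: bij_comp (hom_inv_bij bz l i) (bij_comp (bg l i) (bz l i)).
have bf l i : bijective (f l i).
  by apply: bij_comp (hom_inv_bij bk l i) (bij_comp (bg' l i) (bk l i)).
exists f; split; first exact: bij_automorphism.
move=> l i x; rewrite -(hom_invK bz x) H_along_comp.
have [h _ hK] := bk l i; rewrite -(hK (hom_inv bz l i x)).
move: (h _) => u; rewrite -[kappa l i u]/(hclass u).
have -> : homology_hom f l i (hclass u) = g' l i (kappa l i u).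
  transitivity (kappa l i (f l i u)); last exact: hom_invK.
  exact/hmapE/homology_is_cycle.
exact: hom_invK.
Qed.

Lemma lift_automorphisms_lift_grading (char0 : [pchar k] =i pred0) :
  (exists (P' : operad k) (z : zigzag P' P),
    forall g : operad_hom (homology_operad P) (homology_operad P),
      automorphism g ->
      exists f : operad_hom P' P', automorphism f /\ H_along z f =h g) ->
  exists (P' : operad k) (z : zigzag P' P) (f : operad_hom P' P')
      (alpha : k) (alpha_neq0 : alpha != 0),
    [/\ automorphism f, forall n : nat, (0 < n)%N -> alpha ^+ n != 1
      & H_along z f =h grading_aut P alpha_neq0].
Proof.
(* The scalar 2 is not a root of unity in characteristic zero, since [2 ^ n - 1] is a positive
   integer. *)
move=> [P' [z hz]]; have two0 : 2%:R != 0 :> k by apply: natr_neq0.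
have [f [af hf]] := hz _ (grading_aut_automorphism P two0).
exists P', z, f, 2%:R, two0; split=> // n n0.
rewrite -natrX -subr_eq0 -[X in _ - X]/(1%:R) -natrB ?expn_gt0 //.
have : (1 < 2 ^ n)%N by rewrite -(expn0 2) ltn_exp2l.
by case: (2 ^ n)%N => [|[|m]] // _; rewrite subn1 natr_neq0.
Qed.

(** Through [z] the map induced by [f] in degree [i] becomes multiplication by [alpha ^ i], and the
    weight is the exponent on the powers of [iota alpha]. *)
Lemma lift_grading_pure (K : closedFieldType) (iota : {rmorphism k -> K}) :
  homology_of_finite_type P ->
  (exists (P' : operad k) (z : zigzag P' P) (f : operad_hom P' P')
      (alpha : k) (alpha_neq0 : alpha != 0),
    [/\ automorphism f, forall n : nat, (0 < n)%N -> alpha ^+ n != 1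
      & H_along z f =h grading_aut P alpha_neq0]) ->
  exists (P' : operad k) (z : zigzag P' P) (f : operad_hom P' P')
      (w : weight_function K), pure_endomorphism iota w f.
Proof.
move=> HPfin [P' [z [f [alpha [alpha0 [_ alpha1 hf]]]]]].
have ia0 : iota alpha != 0 by rewrite fmorph_eq0.
have ia1 n : (0 < n)%N -> iota alpha ^+ n != 1.
  by move=> /alpha1; apply: contraNN; rewrite -rmorphXn fmorph_eq1.
have [w hw] := powers_weight ia0 ia1.
exists P', z, f, w => l i.
have [wd we] := hw i.
apply: (pure_scale (a := alpha ^ i)); rewrite ?fmorphXz //.
  have [n [b hb]] := (HPfin l).1 i; have bz := zigzag_hom_bij z.
  exists n, (fun j => hom_inv bz l i (b j)) => v.
  have [c hc] := hb (zigzag_hom z l i v); exists c.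
  apply: (bij_inj (bz l i)); rewrite hc linear_sum; apply: eq_bigr => j _.
  by rewrite linearZ; congr (_ *: _); apply/esym/hom_invK.
move=> v; apply: (bij_inj (zigzag_hom_bij z l i)).
by rewrite -H_along_comp hf linearZ.
Qed.

End Implications.

Theorem theorem5p2p4 (k : fieldType) (char0 : [pchar k] =i pred0)
    (kbar : closedFieldType) (iota : {rmorphism k -> kbar})
    (iota_alg : forall x : kbar, algebraicOver iota x)
    (P : operad k)
    (HP1 : forall (i : int) (x : homology_operad P 0%N i), x = 0)
    (HPfin : homology_of_finite_type P) :
  [<-> formal P;
       exists (P' : operad k) (z : zigzag P' P),
         forall g : operad_hom (homology_operad P) (homology_operad P),
           automorphism g ->
           exists f : operad_hom P' P', automorphism f /\ H_along z f =h g;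
       exists (P' : operad k) (z : zigzag P' P) (f : operad_hom P' P')
           (alpha : k) (alpha_neq0 : alpha != 0),
         [/\ automorphism f,
             forall n : nat, (0 < n)%N -> alpha ^+ n != 1
           & H_along z f =h grading_aut P alpha_neq0];
       exists (P' : operad k) (z : zigzag P' P) (f : operad_hom P' P')
           (w : weight_function kbar), pure_endomorphism iota w f].
Proof.
tfae.
- exact: formal_lift_automorphisms.
- exact: lift_automorphisms_lift_grading.
- exact: lift_grading_pure.
- by move=> [P' [z [f [w]]]]; apply: pure_endomorphism_formal.
Qed.
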